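(* Let a dynamical system on a genus-$p$ surface $S$ be given by $$\dot x=\sum_{i=1}^{k}\Big(\Big(\frac{\partial\psi_i}{\partial y}+\psi_i f_i\Big)\prod_{j\ne i}\psi_j\Big),\qquad \dot y=\sum_{i=1}^{k}\Big(\Big(-\frac{\partial\psi_i}{\partial x}+\psi_i g_i\Big)\prod_{j\ne i}\psi_j\Big),$$ and suppose that it is dissipative relative to a knot $K$ situated on $S$. If there exists an inversely unstable solution $(x_I,y_I)$ within the (knotted) attractor $\mathcal{A}_I$, then $\mathcal{A}_I$ is not homeomorphic to the circle $\mathbb{T}=\mathbb{R}/\mathbb{Z}$.
   Context: Setting. The genus-$p$ surface $S$ is represented by a fundamental domain $F$ in the upper half-plane model of the hyperbolic plane for a Fuchsian group $\Gamma$. The sides of $F$ are identified in pairs by linear fractional maps $T_i(z)=\frac{az+b}{cz+d}$ belonging to $\Gamma$. A vector field $v$ in the half-plane represents a vector field on $S$ when it is compatible with the identifications, i.e. $v(T_i(q))=(T_i)_*(v(q))$ at corresponding points $q$ of paired sides, where $(T_i)_*$ is the tangent map. $F$ is mapped by a map $\phi$, one-to-one on the interior and $C^\infty$ apart from at the cusp points (vertices) of $F$, onto a rectangle $R$ (the modified fundamental region), and the compatibility condition is transported to $R$ by $\phi$. In the displayed system, $\psi_i(x,y,t)$, $1\le i\le k$, are functions whose zero sets are curves in $R$ which do not intersect, which match at the identified boundary sides and which together form a closed curve (a periodic trajectory) on $S$. The $f_i(x,y),g_i(x,y)$ are $C^\infty$ functions chosen so that the vector field satisfies the compatibility condition on identified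 sides. Write the system as $\dot x=F(x,y,t)$, $\dot y=G(x,y,t)$; here $F$ and $G$ are $T$-periodic in $t$. Poincaré map. $P(x_0,y_0)=Y(T;0,(x_0,y_0))$, where $Y(t;0,(x_0,y_0))$ is the solution starting at $(x_0,y_0)$ at time $0$. If $\Gamma_i\in\Gamma$ denotes the transformation from one fundamental region to one next to it, then $P(\Gamma_i(x_0,y_0))=\Gamma_i(P(x_0,y_0))$, so $P$ is well defined on a fundamental region. Knot. A knot on $S$ is a closed curve on $S$ (with $S$ embedded in $\mathbb{R}^3$). Dissipative relative to a knot. A system on a surface $S$ is dissipative relative to a knot $K$ if there is a neighbourhood $N$ of $K$ in $S$ such that on $\partial(S\setminus N)$ the vector field is pointing into $N$. Attractor. A (knotted) attractor is a compact, non-empty, connected invariant set towards which the nearby dynamics converge, obtained by iterating the Poincaré map on a bounded set $B$ provided by dissipativity, i.e. $\bigcap_{n\in\mathbb{N}}P^n(\overline{B})$. $(a,b)$-periodic solutions. For $(a,b)\in\mathbb{Z}\times\mathbb{N}$, $b\ge1$, a solution $z=(x,y)$ is $(a,b)$-periodic iff $z(t+bT)=\Gamma_i^{a}(z(t))$, where $\Gamma_i$ is the map between one fundamental region and the one next to it. Its initial point $A=(x(t_0),y(t_0))$ is then a fixed point of $M=P^b-\big(\Gamma_i^a(z(0))-z(0)\big)$. Inversely unstable. Let $z=(x,y)$ be an $(a,b)$-periodic solution whose initial point $A$ is an isolated fixed point of $M$. Expand the map at $A$: the point $A+(u_0,v_0)$ is sent to $A+(u_1,v_1)$ with $u_1=\alpha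 u_0+\beta v_0+\cdots$, $v_1=\gamma u_0+\delta v_0+\cdots$ (dots denoting higher order terms). The characteristic multipliers $\lambda_1,\lambda_2$ are the roots of $(\alpha-\lambda)(\delta-\lambda)-\beta\gamma=0$. The solution is inversely unstable iff $\lambda_2<-1<\lambda_1<0$.
   Formalization: The map M whose expansion at A gives the multipliers is taken as Γ_i^{-a} composed with P^b, instead of P^b minus the constant vector Γ_i^a(z(0)) − z(0); with the latter the claim fails for a ≠ 0. *)

(* Defs.v *)
From HB Require Import structures.
From mathcomp Require Import all_boot all_order all_algebra generic_quotient.
From mathcomp Require Import complex.
From mathcomp Require Import all_classical all_reals all_analysis.
From mathcomp Require Import ring lra.

Set Implicit Arguments.
Unset Strict Implicit.
Unset Printing Implicit Defensive.

Import Order.TTheory GRing.Theory Num.Theory.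
Import numFieldNormedType.Exports.

Local Open Scope classical_set_scope.
Local Open Scope quotient_scope.
Local Open Scope complex_scope.
Local Open Scope ring_scope.

(* Points of the plane and tangent vectors are pairs (x, y) : R * R, standing *)
(* for x + iy; R * R is a normed space over R, so that the library's          *)
(* [is_derive] and ['d] apply. Complex arithmetic is used in [mobius] only.   *)

Section HalfPlane.
Variable R : realType.

Definition half_plane : set (R * R) := [set q | 0 < q.2].

Definition mobius (g : 'M[R]_2) (q : R * R) : R * R :=
  let z := (q.1 +i* q.2) in
  let w := ((g 0 0)%:C * z + (g 0 1)%:C) / ((g 1 0)%:C * z + (g 1 1)%:C) in
  (complex.Re w, complex.Im w).

(* A subgroup of SL_2(R) whose image in PSL_2(R) is a torsion-free Fuchsian   *)
(* group; -1 may or may not belong to it. Freeness of the action is what      *)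
(* makes the orbit space a surface covered by the half-plane.                 *)
Record fuchsian_group := FuchsianGroup {
  fuchsian_set :> 'M[R]_2 -> Prop;
  fuchsian_det : forall g, fuchsian_set g -> \det g = 1;
  fuchsian1 : fuchsian_set 1;
  fuchsianM : forall g h, fuchsian_set g -> fuchsian_set h ->
    fuchsian_set (g * h);
  fuchsianV : forall g, fuchsian_set g -> fuchsian_set g^-1;
  fuchsian_discrete : \forall g \near (1 : 'M[R]_2), fuchsian_set g -> g = 1;
  fuchsian_free : forall g q, fuchsian_set g -> half_plane q ->
    mobius g q = q -> g = 1 \/ g = -1 }.

Lemma det2 (g : 'M[R]_2) : \det g = g 0 0 * g 1 1 - g 0 1 * g 1 0.
Proof.
rewrite (expand_det_row _ ord0) !big_ord_recl big_ord0 addr0 /cofactor /=.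
rewrite !det_mx11 !mxE /= expr0 expr1 mul1r mulN1r mulrN.
by congr (_ * _ - _ * _); congr (g _ _); apply/val_inj.
Qed.

Lemma mulmx2E (g h : 'M[R]_2) i j : (g * h) i j = g i 0 * h 0 j + g i 1 * h 1 j.
Proof.
rewrite mxE !big_ord_recl big_ord0 addr0.
by congr (_ * _ + _ * _); [congr (g _ _)|congr (h _ _)]; apply/val_inj.
Qed.

Lemma mobius1 q : mobius 1 q = q.
Proof.
case: q => x y; rewrite /mobius !mxE.
rewrite [real_complex _ 0]rmorph0 [real_complex _ 1]rmorph1.
by rewrite mul1r mul0r add0r addr0 divr1.
Qed.

Lemma mobius_denom_neq0 (g : 'M[R]_2) q : \det g = 1 -> half_plane q ->
  (g 1 0)%:C * (q.1 +i* q.2) + (g 1 1)%:C != 0.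
Proof.
rewrite det2 => dg1; rewrite /half_plane /= => q0.
apply/eqP => /(f_equal (fun w => (complex.Re w, complex.Im w))) /=.
case=> /=; rewrite !mul0r subr0 !addr0 => re0 im0.
have c0 : g 1 0 = 0.
  by move/eqP: im0; rewrite mulf_eq0 (gt_eqF q0) orbF => /eqP.
move: re0; rewrite c0 mul0r add0r => d0; move: dg1.
by rewrite c0 d0 !mulr0 subr0 => /esym/eqP; rewrite oner_eq0.
Qed.

Lemma mobiusM (g h : 'M[R]_2) q : \det h = 1 -> half_plane q ->
  mobius (g * h) q = mobius g (mobius h q).
Proof.
move=> dh1 q0; have := mobius_denom_neq0 dh1 q0.
set z := (q.1 +i* q.2) => den0.
pose w := ((h 0 0)%:C * z + (h 0 1)%:C) / ((h 1 0)%:C * z + (h 1 1)%:C).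
have -> : mobius h q = (complex.Re w, complex.Im w) by [].
pose m2 (u : R[i]) := ((g 0 0)%:C * u + (g 0 1)%:C) / ((g 1 0)%:C * u + (g 1 1)%:C).
pose m1 := (((g * h) 0 0)%:C * z + ((g * h) 0 1)%:C)
           / (((g * h) 1 0)%:C * z + ((g * h) 1 1)%:C).
suff e : m1 = m2 w.
  rewrite -[LHS]/(complex.Re m1, complex.Im m1) e.
  rewrite -[RHS]/(let v := m2 (complex.Re w +i* complex.Im w) in
                  (complex.Re v, complex.Im v)).
  by have -> : complex.Re w +i* complex.Im w = w by case: (w).
have CD (x y : R) : (x + y)%:C = x%:C + y%:C by exact: rmorphD.
have CM (x y : R) : (x * y)%:C = x%:C * y%:C by exact: rmorphM.
rewrite /m1 /m2 /w !mulmx2E !CD !CM.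
move: (g 0 0)%:C (g 0 1)%:C (g 1 0)%:C (g 1 1)%:C => a b c d.
move: den0 (h 0 0)%:C (h 0 1)%:C.
move: (h 1 0)%:C (h 1 1)%:C => c' d' den0 a' b'.
have -> : (a * a' + b * c') * z + (a * b' + b * d') =
  (a * ((a' * z + b') / (c' * z + d')) + b) * (c' * z + d') by field.
have -> : (c * a' + d * c') * z + (c * b' + d * d') =
  (c * ((a' * z + b') / (c' * z + d')) + d) * (c' * z + d') by field.
by rewrite -mulf_div divff // mulr1.
Qed.

End HalfPlane.

Section Surface.
Variables (R : realType) (Gamma : fuchsian_group R).
Local Notation H := (set_type (@half_plane R)).

Definition orbit_rel : rel H :=
  fun u v => `[< exists2 g, Gamma g & mobius g (val u) = val v >].

Lemma orbit_equiv_class : equiv_class_of orbit_rel.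
Proof.
have HP (u : H) : half_plane (val u) by exact: set_valP.
split=> [u|u v|v u w].
- by apply/asboolP; exists 1; [exact: fuchsian1|exact: mobius1].
- by apply/idP/idP => /asboolP[g Gg e]; apply/asboolP; exists g^-1;
    [exact: fuchsianV| |exact: fuchsianV|];
    rewrite -e -mobiusM ?(fuchsian_det Gg)// mulVr ?mobius1//;
    rewrite unitmxE (fuchsian_det Gg) unitr1.
- move=> /asboolP[g Gg e1] /asboolP[h Gh e2]; apply/asboolP.
  exists (h * g); first exact: fuchsianM.
  by rewrite mobiusM ?(fuchsian_det Gg)// e1.
Qed.

Canonical orbit_equiv := EquivRelPack orbit_equiv_class.

(* S = H / Gamma with the quotient topology. *)
Definition surface : topologicalType :=
  quotient_topology {eq_quot orbit_equiv}.

Definition surface_pi (u : H) : surface := \pi_({eq_quot orbit_equiv}) u.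

Definition lift_set (A : set surface) : set (R * R) :=
  set_val @` (surface_pi @^-1` A).

(* Points of B outside the half-plane are ignored. *)
Definition push_set (B : set (R * R)) : set surface :=
  surface_pi @` (set_val @^-1` B).

End Surface.

Arguments push_set {R} Gamma B.

Section Circle.
Variable R : realType.

Definition modZ_rel : rel R := fun x y => x - y \is a Num.int.

Lemma modZ_equiv_class : equiv_class_of modZ_rel.
Proof.
split=> [x|x y|y x z]; rewrite /modZ_rel.
- by rewrite subrr rpred0.
- by rewrite -opprB rpredN.
- by move=> xy yz; rewrite -(subrKA y) rpredD.
Qed.

Canonical modZ_equiv := EquivRelPack modZ_equiv_class.

(* R / Z *)
Definition circle : topologicalType :=
  quotient_topology {eq_quot modZ_equiv}.

End Circle.

Definition homeomorphic (X Y : topologicalType) (A : set X) (B : set Y) :=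
  exists (f : X -> Y) (g : Y -> X),
    [/\ {within A, continuous f} /\ {within B, continuous g},
        (forall x, A x -> B (f x)), (forall y, B y -> A (g y)),
        (forall x, A x -> g (f x) = x) & (forall y, B y -> f (g y) = y)].

(* Simple closed curves; also used for knots. *)
Definition closed_curve (R : realType) (X : topologicalType) (C : set X) :=
  exists c : circle R -> X, [/\ continuous c, injective c & range c = C].

Section Smooth.
Variables (R : realType) (V W : normedModType R).

Fixpoint Cn (n : nat) (U : set V) (f : V -> W) : Prop :=
  if n is m.+1 then
    (forall q, U q -> differentiable f q) /\ forall v, Cn m U ('D_v f)
  else forall q, U q -> {for q, continuous f}.

Definition smooth_near (f : V -> W) (q : V) :=
  exists U : set V, [/\ open U, U q & forall n, Cn n U f].

End Smooth.

Section FundamentalRegion.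
Variables (R : realType) (Gamma : fuchsian_group R).

(* A compact region bounded by a Jordan curve which is cut into [nsides]      *)
(* consecutive arcs, the sides. The boundary transformation [trans i] takes   *)
(* side i to side [partner i].                                                *)
Record fundamental_region := FundamentalRegion {
  region : set (R * R);
  nsides : nat;
  side : 'I_nsides -> R -> R * R;
  partner : 'I_nsides -> 'I_nsides;
  trans : 'I_nsides -> 'M[R]_2;
  region_half_plane : region `<=` @half_plane R;
  region_compact : compact region;
  region_closure : closure region° = region;
  region_cover : forall q, half_plane q ->
    exists2 g, Gamma g & region (mobius g q);
  region_tile : forall g q, Gamma g -> region° q -> region° (mobius g q) ->
    g = 1 \/ g = -1;
  region_boundary :
    region `\` region° = \bigcup_(i in [set: 'I_nsides]) (side i @` `[0, 1]);
  side_continuous : forall i, {within `[0, 1], continuous (side i)};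
  side_next : forall i, side i 1 = side (ordS i) 0;
  side_simple : forall i j s t, s \in `[0, 1[ -> t \in `[0, 1[ ->
    side i s = side j t -> i = j /\ s = t;
  partner_neq : forall i, partner i != i;
  partnerK : involutive partner;
  trans_Gamma : forall i, Gamma (trans i);
  trans_partner : forall i, trans (partner i) = (trans i)^-1;
  trans_side : forall i,
    mobius (trans i) @` (side i @` `[0, 1]) = side (partner i) @` `[0, 1] }.

Variable D : fundamental_region.

Definition vertices : set (R * R) :=
  [set side (f := D) i 0 | i in [set: 'I_(nsides D)]].

(* S is obtained from the disc D by identifying its sides in pairs, hence     *)
(* carries a cell structure with one face, [nsides]/2 edges and v vertices:   *)
(* v - nsides / 2 + 1 = 2 - 2 p.                                              *)
Definition has_genus (p : nat) := exists v : nat,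
  (push_set Gamma vertices #= `I_v)%card /\ (v + 1 + 2 * p = (nsides D)./2 + 2)%N.

Definition rectangle (lo hi : R * R) : set (R * R) :=
  [set q | lo.1 <= q.1 <= hi.1 /\ lo.2 <= q.2 <= hi.2].

Definition modified_region (lo hi : R * R) (phi : R * R -> R * R) :=
  [/\ lo.1 < hi.1 /\ lo.2 < hi.2,
      phi @` region D = rectangle lo hi,
      set_inj (region D)° phi
    & forall q, region D q -> ~ vertices q -> smooth_near phi q].

End FundamentalRegion.

Section System.
Variables (R : realType) (k : nat).
Variables (psi : 'I_k -> R -> R -> R -> R) (f g : 'I_k -> R -> R -> R).

Definition sysF (x y t : R) : R :=
  \sum_(i < k) ((derive1 (fun y' => psi i x y' t) y + psi i x y t * f i x y)
                * \prod_(j < k | j != i) psi j x y t).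

Definition sysG (x y t : R) : R :=
  \sum_(i < k) ((- derive1 (fun x' => psi i x' y t) x + psi i x y t * g i x y)
                * \prod_(j < k | j != i) psi j x y t).

Definition regular_data (Q : set (R * R)) :=
  [/\ (forall i x y t, Q (x, y) ->
         differentiable (fun q : R * R => psi i q.1 q.2 t) (x, y)),
      (forall i q, Q q -> smooth_near (fun q : R * R => f i q.1 q.2) q)
    & (forall i q, Q q -> smooth_near (fun q : R * R => g i q.1 q.2) q)].

Definition periodic_system (Q : set (R * R)) (T : R) :=
  forall x y t, Q (x, y) ->
    sysF x y (t + T) = sysF x y t /\ sysG x y (t + T) = sysG x y t.

Definition zero_set (Q : set (R * R)) (t : R) (i : 'I_k) : set (R * R) :=
  [set q | Q q /\ psi i q.1 q.2 t = 0].

End System.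

Definition plane_curve (R : realType) (C : set (R * R)) :=
  exists c : R -> R * R, [/\ {within `[0, 1], continuous c},
    {in `[0, 1[ &, injective c} & C = c @` `[0, 1]].

Section Dynamics.
Variables (R : realType) (Gamma : fuchsian_group R).

(* Integral curves in the half-plane, defined for all times. *)
Definition solution (V : R -> R * R -> R * R) (z : R -> R * R) :=
  forall t : R, half_plane (z t) /\ is_derive t (1 : R) z (V t (z t)).

(* Vector fields on S, as fields in the half-plane compatible with all of     *)
(* Gamma: a field on the fundamental region compatible with the               *)
(* identifications of its sides extends uniquely to such a field.             *)
Definition compatible (V : R -> R * R -> R * R) :=
  forall h t q, Gamma h -> half_plane q ->
    V t (mobius h q) = 'd (mobius h) q (V t q).

(* [phi] carries [V] to (F, G). It may fail to be immersive on a nowhere      *)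
(* dense set and is arbitrary at vertices; there V is fixed by continuity,    *)
(* and the periodicity of (F, G) is restated for V.                           *)
Definition represents (D : fundamental_region Gamma)
    (phi : R * R -> R * R) (F G : R -> R -> R -> R) (T : R)
    (V : R -> R * R -> R * R) :=
  [/\ (forall t q, half_plane q ->
         {for (t, q), continuous (fun u : R * (R * R) => V u.1 u.2)}),
      compatible V,
      (forall t q, half_plane q -> V (t + T) q = V t q)
    & (forall t q, region D q -> ~ vertices D q ->
         'd phi q (V t q)
         = (F (phi q).1 (phi q).2 t, G (phi q).1 (phi q).2 t))].

(* [Y t s q] is the value at time t of the unique solution through q at s.    *)
Definition solution_map (V : R -> R * R -> R * R)
    (Y : R -> R -> R * R -> R * R) :=
  forall s q, half_plane q ->
    [/\ solution V (fun t => Y t s q), Y s s q = q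
      & forall z, solution V z -> z s = q -> forall t, z t = Y t s q].

(* The image in S of a periodic trajectory of the field obtained from V by    *)
(* freezing the time in its right-hand side at t.                             *)
Definition periodic_trajectory (V : R -> R * R -> R * R) (t : R)
    (C : set (surface Gamma)) :=
  exists (y : R -> R * R) (tau : R) (h : 'M[R]_2),
    [/\ solution (fun=> V t) y, 0 < tau, Gamma h,
        (forall s, y (s + tau) = mobius h (y s))
      & push_set Gamma (range y) = C].

Definition zero_sets_form_closed_trajectory (D : fundamental_region Gamma)
    (phi : R * R -> R * R) (Q : set (R * R)) (k : nat)
    (psi : 'I_k -> R -> R -> R -> R) (V : R -> R * R -> R * R) :=
  forall t,
    let Z := \bigcup_(i in [set: 'I_k]) zero_set psi Q t i in
    let C := push_set Gamma (region D `&` phi @^-1` Z) in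
    [/\ (forall i, plane_curve (zero_set psi Q t i)),
        (forall i j, i != j -> zero_set psi Q t i `&` zero_set psi Q t j = set0),
        (forall (i : 'I_(nsides D)) q, (side i @` `[0, 1]) q ->
           Z (phi q) <-> Z (phi (mobius (trans i) q))),
        closed_curve R C & periodic_trajectory V t C].

(* At q, V points into N, for which no smooth boundary is assumed: short      *)
(* segments from q in all directions close to V t q lie in N.                 *)
Definition points_into (N : set (surface Gamma)) (v q : R * R) :=
  exists2 d : R, 0 < d & forall (s : R) (w : R * R),
    0 < s < d -> `|w - v| < d -> lift_set N (q + s *: w).

Definition dissipative_on (V : R -> R * R -> R * R)
    (K N : set (surface Gamma)) :=
  K `<=` N° /\
  forall t q, lift_set (closure (~` N) `\` (~` N)°) q -> points_into N (V t q) q.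

Definition poincare (Y : R -> R -> R * R -> R * R) (T : R) (q : R * R) :=
  Y T 0 q.

Definition attractor (P : R * R -> R * R) (B A : set (surface Gamma)) :=
  [/\ A = \bigcap_(n in [set: nat]) push_set Gamma (iter n P @` lift_set (closure B)),
      [/\ compact A, A !=set0 & connected A],
      push_set Gamma (P @` lift_set A) = A
    & exists2 U : set (surface Gamma), A `<=` U° &
        forall q, lift_set U q -> forall O, open O -> A `<=` O ->
          \forall n \near \oo, lift_set O (iter n P q)].

Definition ab_periodic (V : R -> R * R -> R * R) (T : R) (g : 'M[R]_2)
    (a : int) (b : nat) (z : R -> R * R) :=
  [/\ (0 < b)%N, solution V z & forall t, z (t + b%:R * T) = mobius (g ^ a) (z t)].

(* P^b with the displacement from z(0) to g^a(z(0)) undone. In the half-plane *)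
(* this displacement is the isometry g^a; it is the subtraction of a constant *)
(* vector only in coordinates in which g acts as a translation. Undoing g^a   *)
(* makes the derivative at z(0) that of the return map on S.                  *)
Definition return_map (P : R * R -> R * R) (g : 'M[R]_2) (a : int) (b : nat)
    (q : R * R) : R * R :=
  mobius (g ^ (- a)) (iter b P q).

Definition isolated_fixed_point (M : R * R -> R * R) (A : R * R) :=
  M A = A /\ \forall q \near A, M q = q -> q = A.

Definition inversely_unstable_at (M : R * R -> R * R) (A : R * R) :=
  exists alpha beta gamma delta lambda1 lambda2 : R,
    [/\ isolated_fixed_point M A,
        differentiable M A,
        (forall u v, 'd M A (u, v)
                     = (alpha * u + beta * v, gamma * u + delta * v)),
        (forall lambda, (alpha - lambda) * (delta - lambda) - beta * gamma
                        = (lambda - lambda1) * (lambda - lambda2))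
      & lambda2 < -1 /\ -1 < lambda1 < 0].

(* z(0) is the initial point, as the Poincare map starts at time 0. *)
Definition inversely_unstable (D : fundamental_region Gamma)
    (V : R -> R * R -> R * R) (P : R * R -> R * R) (T : R)
    (z : R -> R * R) :=
  exists (i : 'I_(nsides D)) (a : int) (b : nat),
    ab_periodic V T (trans i) a b z /\
    inversely_unstable_at (return_map P (trans i) a b) (z 0).

End Dynamics.

(* Main.v *)
Require Import Defs.
From mathcomp Require Import all_boot all_order all_algebra generic_quotient.
From mathcomp Require Import complex.
From mathcomp Require Import all_classical all_reals all_analysis.
From mathcomp Require Import ring lra zify.

(* Assume that A is a topological circle and lift it to a path c in the       *)
(* half-plane with c(0) = z(0). The return map M at z(0) satisfies            *)
(* M (c s) = c (sigma s) for a monotone homeomorphism sigma of the line       *)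
(* with sigma 0 = 0 and sigma (s + 1) = sigma s + 1 or sigma s - 1.           *)
(*  - sigma is not increasing: the points of c close to z(0) on one side      *)
(*    would form an orbit-invariant arc, either attracted by or repelled from *)
(*    the saddle z(0), hence inside the stable or the unstable cone minus its *)
(*    apex. But M exchanges the two halves of each cone, as both eigenvalues  *)
(*    are negative.                                                           *)
(*  - sigma is not decreasing: if k is the deck transformation                *)
(*    c(s) -> c(s + 1), then a conjugate of k by an element of Gamma is the   *)
(*    inverse of k, which in a group without elliptic elements forces k to be *)
(*    trivial, so that c is a Jordan curve in the half-plane reversed by M.   *)
(*    As M is isotopic to the identity, the odd loop c(s) - c(s + 1/2) is     *)
(*    then homotopic, through odd loops that avoid 0, to its own reversal;    *)
(*    but odd loops have odd, hence nonzero, degree.                          *)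

Set Implicit Arguments.
Unset Strict Implicit.
Unset Printing Implicit Defensive.

Import Order.TTheory GRing.Theory Num.Theory.
Import numFieldNormedType.Exports.

Local Open Scope classical_set_scope.
Local Open Scope ring_scope.

(** * Lifting of paths *)

(** At z(0) the return map M is a saddle with two negative eigenvalues, and no M-invariant circle
    can pass through such a point. The argument takes place in the half-plane: [circle_lift] unrolls
    the circle to a path [c] from z(0), on which M acts by a continuous [sigma] with [sigma 0 = 0].
    Since M is injective and equivariant up to conjugation, [sigma] lifts an injective circle map,
    and [circle_map_degree] makes it strictly monotone, of degree 1 or -1.

    An increasing [sigma] is refuted locally, in [saddle_curve]: M preserves the half-arc of [c] on
    one side of z(0), which near z(0) lies in a cone around one eigendirection, where the dominant
    coordinate never vanishes although M changes its sign. A decreasing [sigma] is refuted globally: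
    by [conj_eq_inverse] the path [c] closes up in the half-plane, and [no_reversed_loop] excludes a
    Jordan curve reversed by a map isotopic to the identity, by counting half turns as in
    [odd_loop_not_reversible].

    Two tools support this. [fuchsian_locally_free] makes the half-plane a covering of the surface,
    to which [path_lifting] applies. [field_bound] bounds the hyperbolic speed of the field, from
    which [flow_continuous] derives continuous dependence on initial points, using uniqueness of
    solutions only. *)

Lemma continuous_pair (T U V : topologicalType) (f : T -> U) (g : T -> V) t :
  {for t, continuous f} -> {for t, continuous g} ->
  {for t, continuous (fun s => (f s, g s))}.
Proof. by move=> cf cg; exact: cvg_pair cf cg. Qed.

Lemma continuous_fst (T U V : topologicalType) (f : T -> U * V) t :
  {for t, continuous f} -> {for t, continuous (fun s => (f s).1)}.
Proof. by move=> cf; exact: (cvg_comp _ _ cf (@cvg_fst _ _ _ (nbhs (f t).2) _)). Qed.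

Lemma continuous_snd (T U V : topologicalType) (f : T -> U * V) t :
  {for t, continuous f} -> {for t, continuous (fun s => (f s).2)}.
Proof. by move=> cf; exact: (cvg_comp _ _ cf (@cvg_snd _ _ (nbhs (f t).1) _ _)). Qed.

Lemma continuous_sqr (R : realType) (T : topologicalType) (f : T -> R) t :
  {for t, continuous f} -> {for t, continuous (fun s => f s ^+ 2)}.
Proof.
move=> cf; rewrite (_ : (fun s => _) = (fun s => f s * f s))//.
exact: continuousM.
Qed.

Section Covering.
Variables (R : realType) (X B : topologicalType).

(** Covering data common to R over R/Z and the half-plane over the surface. Openness and local
    injectivity give continuous local sections of [pi]; [G] moves them to any point of the fibre. *)
Definition orbit_covering (G : set (X -> X)) (pi : X -> B) :=
  [/\ (forall b, exists x, pi x = b),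
      (forall U, open U -> open (pi @` U)),
      (forall g, G g -> continuous g /\ forall x, pi (g x) = pi x),
      (forall x y, pi x = pi y -> exists2 g, G g & y = g x)
    & (forall x, exists U, [/\ open U, U x & set_inj U pi])].

Lemma continuous_glue (Z : topologicalType) (f g : R -> Z) b :
  continuous f -> continuous g -> f b = g b ->
  continuous (fun t => if t <= b then f t else g t).
Proof.
move=> cf cg fg t W /= nW.
suff: \forall s \near t, W (if s <= b then f s else g s) by [].
move: nW.
have [tb|bt|->] := ltgtP t b.
- move=> /(cf t W) Wf.
  have lt_near : \forall s \near t, s < b by apply: lt_nbhsl.
  by near=> s => /=; rewrite ltW; near: s.
- move=> /(cg t W) Wg.
  have gt_near : \forall s \near t, b < s by apply: lt_nbhsr.
  by near=> s => /=; rewrite leNgt (_ : b < s = true)//=; near: s.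
- move=> Wf.
  have Wg : nbhs (g b) W by rewrite -fg.
  have := cf b W Wf; have := cg b W Wg => h1 h2.
  near=> s => /=; case: ifP => _; near: s; [exact: h2|exact: h1].
Unshelve. all: by end_near. Qed.

(** Retraction of the line onto an interval: paths on [[a, b]] become paths on the whole line, so
    that continuity need not be relativised. *)
Definition clamp (a b t : R) : R := Num.min (Num.max a t) b.

Lemma continuous_clamp a b : continuous (clamp a b).
Proof.
move=> t; apply: (@continuous_min _ _ (fun t => Num.max a t) (fun=> b)).
  by apply: (@continuous_max _ _ (fun=> a) id); [exact: cvg_cst|exact: cvg_id].
exact: cvg_cst.
Qed.

Lemma clampE a b t : a <= t <= b -> clamp a b t = t.
Proof. by case/andP => at_ tb; rewrite /clamp (max_idPr at_) (min_idPl tb). Qed.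

Lemma clamp_itv a b t : a <= b -> a <= clamp a b t <= b.
Proof. by move=> ab; rewrite /clamp le_min ab le_max lexx/= ge_min lexx orbT. Qed.

(** The lifts agree on a set that is open by local injectivity and closed because [X] is Hausdorff;
    the line is connected. *)
Lemma lift_unique (pi : X -> B) (c1 c2 : R -> X) t0 :
  hausdorff_space X ->
  (forall x, exists U, [/\ open U, U x & set_inj U pi]) ->
  continuous c1 -> continuous c2 -> (forall t, pi (c1 t) = pi (c2 t)) ->
  c1 t0 = c2 t0 -> c1 = c2.
Proof.
move=> hX loc k1 k2 pic c0.
have conR : connected [set: R] by apply/connected_intervalP.
pose E := [set t | c1 t = c2 t].
have oE : open E.
  rewrite openE => t Et; rewrite /interior.
  have [U [oU Ut injU]] := loc (c1 t).
  have U1 : \forall s \near t, U (c1 s) by apply: k1; exact: open_nbhs_nbhs.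
  have U2 : \forall s \near t, U (c2 s).
    by apply: k2; rewrite -Et; exact: open_nbhs_nbhs.
  near=> s; apply: injU; last exact: pic.
  - by apply/mem_set; near: s.
  - by apply/mem_set; near: s.
have cE : closed E.
  rewrite -[E]setCK; apply: open_closedC; rewrite openE => t nEt; rewrite /interior.
  have /eqP ne : c1 t <> c2 t by [].
  move: hX; rewrite open_hausdorff => /(_ _ _ ne)[[U1 U2]] [m1 m2] [q1 q2 dis].
  move: m1 m2; rewrite /= !inE => m1 m2.
  have V1 : \forall s \near t, U1 (c1 s) by apply: k1; exact: open_nbhs_nbhs.
  have V2 : \forall s \near t, U2 (c2 s) by apply: k2; exact: open_nbhs_nbhs.
  near=> s => Es.
  move/eqP: dis; apply/eqP/set0P; exists (c1 s); split; first by near: s.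
  rewrite Es; by near: s.
have ET : E = [set: R].
  apply: conR; first by exists t0.
  - by exists E => //; rewrite setTI.
  - by exists E => //; rewrite setTI.
by apply/funext => t; have : [set: R] t by []; rewrite -ET.
Unshelve. all: by end_near. Qed.

(** A local section is composed with [gam], and an element of [G] moves the result to the prescribed
    point. One [d] serves all starting times near [t0], which lets a lift be continued past a
    supremum. *)
Lemma local_lift (G : set (X -> X)) (pi : X -> B) (gam : R -> B) t0 :
  orbit_covering G pi -> continuous gam ->
  exists2 d : R, 0 < d & forall t1 x, `|t1 - t0| < d -> pi x = gam t1 ->
    exists l : R -> X, [/\ continuous l, l t1 = x &
      forall t, `|t - t0| < d -> pi (l t) = gam t].
Proof.
move=> [sur op Gc fib loc] cg.
have [x0 x0E] := sur (gam t0).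
have [U [oU Ux0 injU]] := loc x0.
have nU : \forall t \near t0, (pi @` U) (gam t).
  by apply: cg; apply: open_nbhs_nbhs; split; [exact: op|exists x0].
have /nbhs_ballP[e /= e0 eU] := nU.
pose d := e / 2; have d0 : 0 < d by rewrite divr_gt0.
(* Clamping keeps the path in the image of [U], where the section is defined. *)
pose ga t := gam (clamp (t0 - d) (t0 + d) t).
have cga : continuous ga.
  by move=> t; apply: continuous_comp; [exact: continuous_clamp|exact: cg].
have gaU t : exists x, U x /\ pi x = ga t.
  have /andP[c1 c2] : t0 - d <= clamp (t0 - d) (t0 + d) t <= t0 + d.
    by apply: clamp_itv; lra.
  have /eU[x Ux xE] : ball t0 e (clamp (t0 - d) (t0 + d) t).
    rewrite /ball /= ltr_norml; apply/andP; split; rewrite /d in c1 c2 *; lra.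
  by exists x.
have [l lP] := choice gaU.
have cl : continuous l.
  move=> t W /= nW; suff: \forall s \near t, W (l s) by [].
  move: nW; rewrite nbhsE => -[V [oV Vt] VW].
  (* As [pi] is injective on [U], a point of [U] and [V] over [ga s] can only be [l s]. *)
  have : \forall s \near t, (pi @` (U `&` V)) (ga s).
    apply: cga; apply: open_nbhs_nbhs; split; first by apply: op; exact: openI.
    by exists (l t); [split=> //; exact: (lP t).1|exact: (lP t).2].
  apply: filterS => s [x [Ux Vx] xE]; apply: VW.
  suff -> : l s = x by [].
  by apply: injU; [exact/mem_set/(lP s).1|exact/mem_set|rewrite (lP s).2].
have gaE t : `|t - t0| < d -> ga t = gam t.
  rewrite ltr_norml => /andP[h1 h2]; rewrite /ga clampE//.
  by apply/andP; split; lra.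
exists d => // t1 x t1d xE.
have [|g Gg xE'] := fib (l t1) x; first by rewrite (lP t1).2 gaE.
have [gc gpi] := Gc _ Gg.
exists (g \o l); split; last by move=> t td; rewrite /= gpi (lP t).2 gaE.
- by move=> t; apply: continuous_comp; [exact: cl|exact: gc].
- by rewrite /= -xE'.
Qed.

(** If the times reached by lifts were bounded, [local_lift] at their supremum would reach further.
    The result is constant before time 0, and [path_lifting] glues it to the lift of the reversed
    path. *)
Lemma lift_forward (G : set (X -> X)) (pi : X -> B) (gam : R -> B) x0 :
  hausdorff_space X -> orbit_covering G pi -> continuous gam -> pi x0 = gam 0 ->
  exists c : R -> X, [/\ continuous c, (forall t, t <= 0 -> c t = x0)
    & forall t, 0 <= t -> pi (c t) = gam t].
Proof.
move=> hX cov cg x0E; have loc : forall x, exists U, [/\ open U, U x & set_inj U pi].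
  by case: cov.
pose E := [set b : R | exists c : R -> X, [/\ continuous c, c 0 = x0 &
  forall t, 0 <= t <= b -> pi (c t) = gam t]].
have E0 : E 0.
  exists (fun=> x0); split => //; first by move=> t; exact: cvg_cst.
  by move=> t t0; rewrite (_ : t = 0)//; lra.
have Eall b : E b.
  apply: contrapT => nEb.
  have ubE : ubound E b.
    move=> a [c [cc c0 cE]]; rewrite leNgt; apply/negP => ba; apply: nEb.
    exists c; split => // t t_; apply: cE; lra.
  have supE : has_sup E by split; [exists 0|exists b].
  have [d d0 dP] := local_lift (sup E) cov cg.
  have [a [c [cc c0 cE]] aE] := sup_adherent d0 supE.
  have a_le : a <= sup E by apply: ub_le_sup; [exists b|exists c].
  (* Membership of a negative [a] in [E] carries no information beyond time 0; the local lift then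
     starts at 0, which is within [d] of the supremum. *)
  have [an0|a0] := ltP a 0.
    have : 0 <= sup E by apply: ub_le_sup => //; exists b.
    move=> s0; have [|l [cl l0 lP]] := dP 0 x0 _ x0E.
      by rewrite ltr_norml; apply/andP; split; lra.
    have : E (sup E + d / 2).
      exists l; split => // t t_; apply: lP; rewrite ltr_norml; apply/andP; split; lra.
    by move/(ub_le_sup (ex_intro _ b ubE)); lra.
  have [||l [cl l0 lP]] := dP a (c a).
  - by rewrite ltr_norml; apply/andP; split; lra.
  - by apply: cE; rewrite a0 lexx.
  have : E (sup E + d / 2).
    exists (fun t => if t <= a then c t else l t); split.
    - exact: continuous_glue.
    - by rewrite a0.
    - move=> t t_; case: ifP => ta; first by apply: cE; lra.
      move/negbT: ta; rewrite -ltNge => ta.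
      apply: lP; rewrite ltr_norml; apply/andP; split; lra.
  by move/(ub_le_sup (ex_intro _ b ubE)); lra.
have [C CP] := choice Eall.
(* By uniqueness the chosen lifts agree where they overlap, so the diagonal [C t t] is a lift. *)
have Ceq a b t : 0 <= t <= a -> t <= b -> C a t = C b t.
  move=> /andP[t0 ta] tb; have [ca a0 aE] := CP a; have [cb b0 bE] := CP b.
  suff : C a \o clamp 0 t = C b \o clamp 0 t.
    by move/(congr1 (fun f => f t)) => /=; rewrite clampE// t0 lexx.
  apply: (@lift_unique pi _ _ 0 hX loc).
  - by move=> s; apply: continuous_comp; [exact: continuous_clamp|exact: ca].
  - by move=> s; apply: continuous_comp; [exact: continuous_clamp|exact: cb].
  - move=> s /=; have /andP[s0 st] := clamp_itv s t0.
    by rewrite aE ?bE// s0/=; apply: le_trans st _.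
  - by rewrite /= clampE ?lexx// a0 b0.
pose c t := if t <= 0 then x0 else C t t.
exists c; split.
(* Near [t] the diagonal coincides with the single lift up to [t + 1]. *)
- move=> t; pose c' s := if s <= 0 then x0 else C (t + 1) s.
  have cc' : continuous c'.
    apply: continuous_glue; [by move=> s; exact: cvg_cst| by case: (CP (t+1))|].
    by case: (CP (t + 1)).
  have ec : \forall s \near t, c' s = c s.
    have lt1 : \forall s \near t, s < t + 1 by apply: lt_nbhsl; rewrite ltrDl.
    near=> s; rewrite /c' /c; case: leP => // s0; apply: Ceq => //.
    rewrite ltW//=; apply/ltW; near: s; exact: lt1.
  rewrite /continuous_at -(nbhs_singleton ec).
  by apply: cvg_trans (cc' t); apply: near_eq_cvg.
- by move=> t t0; rewrite /c t0.
- move=> t t0; rewrite /c; case: leP => [t0'|t0'].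
    by rewrite (_ : t = 0)//; lra.
  by have [_ _ ->] := CP t; rewrite ?t0 ?lexx.
Unshelve. all: by end_near. Qed.

Lemma path_lifting (G : set (X -> X)) (pi : X -> B) (gam : R -> B) x0 :
  hausdorff_space X -> orbit_covering G pi -> continuous gam -> pi x0 = gam 0 ->
  exists c : R -> X, [/\ continuous c, c 0 = x0 & forall t, pi (c t) = gam t].
Proof.
move=> hX cov cg x0E.
have [c1 [cc1 c10 c1E]] := lift_forward hX cov cg x0E.
have cgN : continuous (gam \o -%R).
  by move=> t; apply: continuous_comp; [exact: oppr_continuous|exact: cg].
have [|c2 [cc2 c20 c2E]] := lift_forward hX cov cgN (x0 := x0).
  by rewrite /= oppr0.
exists (fun t => if t <= 0 then c2 (- t) else c1 t); split.
- apply: continuous_glue => //; last by rewrite oppr0 c10// c20.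
  by move=> t; apply: continuous_comp; [exact: oppr_continuous|exact: cc2].
- by rewrite lexx oppr0 c20.
- move=> t; case: leP => t0; last by rewrite c1E// ltW.
  by rewrite c2E/= ?opprK// oppr_ge0.
Qed.

End Covering.

(** * The covering of the circle by the line *)

Section CircleCovering.
Local Open Scope quotient_scope.
Variable R : realType.

Definition circle_pi (x : R) : circle R := \pi_({eq_quot modZ_equiv R}) x.

Lemma circle_piP x y : circle_pi x = circle_pi y <-> x - y \is a Num.int.
Proof. by split=> [/eqmodP//|h]; apply/eqmodP. Qed.

Lemma circle_pi_surj (b : circle R) : exists x, circle_pi x = b.
Proof. by exists (repr b); rewrite /circle_pi reprK. Qed.

Lemma circle_pi_continuous : continuous circle_pi.
Proof. exact: pi_continuous. Qed.

Lemma circle_pi_open U : open U -> open (circle_pi @` U).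
Proof.
move=> oU; suff: open (circle_pi @^-1` (circle_pi @` U)) by [].
have -> : circle_pi @^-1` (circle_pi @` U) =
    \bigcup_(n in [set: int]) ((fun x => x + n%:~R) @^-1` U).
  apply/seteqP; split => [x [y Uy /circle_piP /intrP[n yx]]|x [n _ /= Un]].
    by exists n => //=; rewrite -yx addrC subrK.
  exists (x + n%:~R) => //; apply/circle_piP.
  by rewrite addrC addKr intr_int.
apply: bigcup_open => n _; apply: open_comp => // x _.
by apply: continuousD; [exact: cvg_id|exact: cvg_cst].
Qed.

Lemma circle_covering :
  orbit_covering [set g : R -> R | exists n : int, g = fun x => x + n%:~R] circle_pi.
Proof.
split.
- exact: circle_pi_surj.
- exact: circle_pi_open.
- move=> _ [n ->]; split; last first.
    by move=> x; apply/circle_piP; rewrite addrC addKr intr_int.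
  by move=> x; apply: continuousD; [exact: cvg_id|exact: cvg_cst].
- move=> x y /esym /circle_piP /intrP[n yx].
  by exists (fun x => x + n%:~R); [exists n|rewrite -yx addrC subrK].
- move=> x; exists (ball x (4^-1 : R)); split.
  + exact: ball_open.
  + by apply: ballxx; rewrite invr_gt0.
  + move=> y z /set_mem; rewrite /ball/= => xy /set_mem xz.
    move=> /circle_piP /intrP[n nE].
    have : `|n%:~R : R| < 1.
      rewrite -nE; move: xy xz; rewrite !ltr_norml => /andP[? ?] /andP[? ?].
      by apply/andP; split; lra.
    rewrite -intr_norm -[1]/(1%:~R) ltr_int => n1.
    have n0 : n = 0 by apply/eqP; rewrite -normr_le0 -ltzD1 add0r.
    by move: nE; rewrite n0 => /eqP; rewrite subr_eq0 => /eqP.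
Qed.

End CircleCovering.

(** * Moebius transformations *)

Section Mobius.
Variable R : realType.
Implicit Types (g h : 'M[R]_2) (q v : R * R).

(** The squared modulus of the denominator c z + d. *)
Definition mobius_den g q : R :=
  (g 1 0 * q.1 + g 1 1) ^+ 2 + (g 1 0 * q.2) ^+ 2.

Lemma mobiusE g q : mobius g q =
  (((g 0 0 * q.1 + g 0 1) * (g 1 0 * q.1 + g 1 1) + g 0 0 * g 1 0 * q.2 ^+ 2)
     / mobius_den g q,
   \det g * q.2 / mobius_den g q).
Proof.
rewrite det2 /mobius /mobius_den /= !mul0r !subr0 !addr0.
by congr (_, _); ring.
Qed.

Lemma mobius_den_gt0 g q : \det g != 0 -> half_plane q -> 0 < mobius_den g q.
Proof.
rewrite det2 /half_plane /= => dg q0; rewrite /mobius_den.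
rewrite lt0r addr_ge0 ?sqr_ge0// andbT paddr_eq0 ?sqr_ge0// !sqrf_eq0.
apply/negP => /andP[/eqP e1]; rewrite mulf_eq0 (gt_eqF q0) orbF => /eqP c0.
move: e1 dg; rewrite c0 mul0r add0r => ->; rewrite !mulr0 subr0.
by rewrite eqxx.
Qed.

(** Stated for positive determinant, like [mobius_inj], because the isotopy in [no_reversed_loop]
    runs through matrices whose determinant need not be 1. *)
Lemma mobius_half_plane g q : 0 < \det g -> half_plane q ->
  half_plane (mobius g q).
Proof.
move=> dg q0; rewrite mobiusE /half_plane /=.
by rewrite divr_gt0 ?mulr_gt0// mobius_den_gt0 ?gt_eqF.
Qed.

Lemma mobius_inj g q q' : 0 < \det g -> half_plane q -> half_plane q' ->
  mobius g q = mobius g q' -> q = q'.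
Proof.
move=> dg q0 q'0.
have cden (p : R * R) : half_plane p ->
    ((g 1 0)%:C * (p.1 +i* p.2) + (g 1 1)%:C)%C != 0.
  move=> p0; apply/eqP => /(f_equal (fun w => (complex.Re w, complex.Im w))) /=.
  case; rewrite !mul0r subr0 !addr0 => e1 e2.
  have := mobius_den_gt0 (lt0r_neq0 dg) p0.
  by rewrite /mobius_den e1 e2 expr0n addr0 ltxx.
have := cden _ q0; have := cden _ q'0.
rewrite /mobius; case: q q' q0 q'0 => [x y] [x' y'] _ _.
set a := (g 0 0)%:C%C; set b := (g 0 1)%:C%C; set c := (g 1 0)%:C%C.
set d := (g 1 1)%:C%C; set z := (x +i* y)%C; set z' := (x' +i* y')%C.
move=> nz' nz e.
have {}e : (a * z + b) / (c * z + d) = (a * z' + b) / (c * z' + d).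
  have inj (u v : R[i]) : (complex.Re u, complex.Im u) = (complex.Re v, complex.Im v) -> u = v.
    by case: u v => ? ? [? ?] /= [-> ->].
  exact: inj e.
(* Once denominators are cleared, the two images differ by the determinant times [z - z']. *)
have : (a * d - b * c) * (z - z') = 0.
  move/eqP: e; rewrite eqr_div // => /eqP e.
  transitivity ((a * z + b) * (c * z' + d) - (a * z' + b) * (c * z + d)); first by ring.
  by rewrite e subrr.
have -> : a * d - b * c = ((\det g)%:C)%C by rewrite det2 rmorphB !rmorphM.
move/eqP; rewrite mulf_eq0 => /orP[|].
  by rewrite eq_complex /= (gt_eqF dg).
rewrite subr_eq0 => /eqP; rewrite /z /z'; case=> -> ->//.
Qed.

Lemma mobius_continuous (T : topologicalType) (g : T -> 'M[R]_2) (q : T -> R * R) t :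
  (forall i j, {for t, continuous (fun s => g s i j)}) ->
  {for t, continuous q} -> \det (g t) != 0 -> half_plane (q t) ->
  {for t, continuous (fun s => mobius (g s) (q s))}.
Proof.
move=> cg cq dg q0.
have den0 := mobius_den_gt0 dg q0.
have c1 := continuous_fst cq; have c2 := continuous_snd cq.
have cden : {for t, continuous (fun s => mobius_den (g s) (q s))}.
  apply: continuousD; apply: continuous_sqr.
    by apply: continuousD => //; exact: continuousM.
  exact: continuousM.
rewrite (_ : (fun s => mobius _ _) = (fun s =>
  (((g s 0 0 * (q s).1 + g s 0 1) * (g s 1 0 * (q s).1 + g s 1 1)
      + g s 0 0 * g s 1 0 * (q s).2 ^+ 2) / mobius_den (g s) (q s),
   (g s 0 0 * g s 1 1 - g s 0 1 * g s 1 0) * (q s).2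
     / mobius_den (g s) (q s)))); last first.
  by apply/funext => s; rewrite mobiusE det2.
apply: continuous_pair.
  apply: continuousM; last by apply: continuousV => //; rewrite gt_eqF.
  apply: continuousD.
    by apply: continuousM; apply: continuousD => //; apply: continuousM.
  by apply: continuousM; [apply: continuousM|exact: continuous_sqr].
apply: continuousM; last by apply: continuousV => //; rewrite gt_eqF.
by apply: continuousM => //; apply: continuousB; apply: continuousM.
Qed.

Lemma is_diff_fst (q : R * R) : is_diff q fst (fst : R * R -> R).
Proof.
apply: DiffDef; first by apply: linear_differentiable => x; exact: cvg_fst.
by apply: diff_lin => x; exact: cvg_fst.
Qed.

Lemma is_diff_snd (q : R * R) : is_diff q snd (snd : R * R -> R).
Proof.
apply: DiffDef; first by apply: linear_differentiable => x; exact: cvg_snd.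
by apply: diff_lin => x; exact: cvg_snd.
Qed.

Lemma is_diffV (f df : R * R -> R) q : f q != 0 -> is_diff q f df ->
  is_diff q (fun y => (f y)^-1) (fun v => - (f q) ^- 2 * df v).
Proof.
move=> f0 [fd <-]; apply: DiffDef; first exact: differentiableV.
by rewrite diffV.
Qed.

Lemma is_diff_ext (W : normedModType R) (f df dg : R * R -> W) q :
  is_diff q f df -> df =1 dg -> is_diff q f dg.
Proof. by move=> fd /funext <-. Qed.

(** The complex derivative is (c z + d)^-2. With c z + d = p + i r this is multiplication by (p - i
    r)^2 / n^2, in real coordinates. *)
Lemma is_diff_mobius g q : \det g = 1 -> half_plane q ->
  is_diff q (mobius g) (fun v =>
   let p := g 1 0 * q.1 + g 1 1 in let r := g 1 0 * q.2 in
   let n := mobius_den g q in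
   ((v.1 * (p ^+ 2 - r ^+ 2) + v.2 * (2 * p * r)) / n ^+ 2,
    (v.2 * (p ^+ 2 - r ^+ 2) - v.1 * (2 * p * r)) / n ^+ 2)).
Proof.
move=> dg q0.
have den0 : mobius_den g q != 0.
  by rewrite gt_eqF// mobius_den_gt0// dg oner_eq0.
have d1 := is_diff_fst q; have d2 := is_diff_snd q.
have dD (f df h dh : R * R -> R) : is_diff q f df -> is_diff q h dh ->
    is_diff q (fun p => f p + h p) (fun v => df v + dh v) := @is_diffD _ _ _ _ _ _ _ _.
have dM (f df h dh : R * R -> R) : is_diff q f df -> is_diff q h dh ->
    is_diff q (fun p => f p * h p) (fun v => f q * dh v + h q * df v) := @is_diffM _ _ _ _ _ _ _.
have dA (f df : R * R -> R) k m : is_diff q f df ->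
    is_diff q (fun p => k * f p + m) (fun v => k * df v).
  move=> fd; have this := dD _ _ _ _ (dM _ _ _ _ (is_diff_cst k q) fd) (is_diff_cst m q).
  by apply: is_diff_ext this _ => v /=; rewrite mulr0 !addr0.
have dN := dD _ _ _ _ (dM _ _ _ _ (dA _ _ (g 1 0) (g 1 1) d1) (dA _ _ (g 1 0) (g 1 1) d1))
  (dM _ _ _ _ (dA _ _ (g 1 0) 0 d2) (dA _ _ (g 1 0) 0 d2)).
have den0' : (g 1 0 * q.1 + g 1 1) * (g 1 0 * q.1 + g 1 1) +
    (g 1 0 * q.2 + 0) * (g 1 0 * q.2 + 0) != 0.
  by rewrite addr0 -!expr2.
have dI := is_diffV den0' dN.
have d01 := dM _ _ _ _ (dD _ _ _ _
  (dM _ _ _ _ (dA _ _ (g 0 0) (g 0 1) d1) (dA _ _ (g 1 0) (g 1 1) d1))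
  (dM _ _ _ _ (dA _ _ (g 0 0 * g 1 0) 0 d2) d2)) dI.
have d02 := dM _ _ _ _ d2 dI.
have dm := is_diff_pair d01 d02.
have mE : mobius g = fun p => (
    ((g 0 0 * p.1 + g 0 1) * (g 1 0 * p.1 + g 1 1)
      + (g 0 0 * g 1 0 * p.2 + 0) * p.2)
    * ((g 1 0 * p.1 + g 1 1) * (g 1 0 * p.1 + g 1 1)
      + (g 1 0 * p.2 + 0) * (g 1 0 * p.2 + 0))^-1,
    p.2 * ((g 1 0 * p.1 + g 1 1) * (g 1 0 * p.1 + g 1 1)
      + (g 1 0 * p.2 + 0) * (g 1 0 * p.2 + 0))^-1).
  apply/funext => p; rewrite mobiusE dg mul1r /mobius_den !expr2 !addr0.
  by rewrite mulrA.
rewrite mE; move: dm.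
move/is_diff_ext; apply => v /=.
move: dg; rewrite det2 => dg; move: den0'; rewrite !addr0 => den0'.
rewrite /mobius_den !expr2 /=.
clear mE dN dI d01 d02 den0 q0; move: dg den0'.
move: (g 0 0) (g 0 1) (g 1 0) (g 1 1) => a b c d dg.
move: v q {d1 d2 dD dM dA} => [v w] [x y] /= nz.
congr (_, _); last by field.
(* The determinant, equal to 1, is inserted to make the two rational functions identical. *)
by rewrite -[RHS]mul1r -[X in _ = X * _]dg; field.
Qed.

(** Invariance of the hyperbolic norm |v| / Im q, in squared form. *)
Lemma diff_mobius_norm g q v : \det g = 1 -> half_plane q ->
  ('d (mobius g) q v).1 ^+ 2 + ('d (mobius g) q v).2 ^+ 2 =
  (v.1 ^+ 2 + v.2 ^+ 2) * ((mobius g q).2 / q.2) ^+ 2.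
Proof.
move=> dg q0; have [_ ->] := is_diff_mobius dg q0.
rewrite mobiusE dg mul1r /=.
have := @mobius_den_gt0 g q _ q0; rewrite dg oner_eq0 => /(_ isT)/lt0r_neq0.
have /lt0r_neq0 : 0 < q.2 by [].
rewrite /mobius_den; case: q {q0} => x y; case: v => v w /=.
move=> y0 n0; field; exact/andP.
Qed.

End Mobius.

(** * Fuchsian groups *)

Section Fuchsian.
Variable R : realType.
Implicit Types (g h : 'M[R]_2) (q v : R * R).

Lemma ord2_cases (k : 'I_2) : k = 0 \/ k = 1.
Proof. by case: k => -[|[|//]] i; [left|right]; apply/val_inj. Qed.

Lemma mx2_eq g h : g 0 0 = h 0 0 -> g 0 1 = h 0 1 -> g 1 0 = h 1 0 ->
  g 1 1 = h 1 1 -> g = h.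
Proof.
move=> e00 e01 e10 e11; apply/matrixP => i j.
by case: (ord2_cases i) => ->; case: (ord2_cases j) => ->.
Qed.

Lemma inv_mx2 g : \det g = 1 ->
  [/\ g^-1 0 0 = g 1 1, g^-1 0 1 = - g 0 1, g^-1 1 0 = - g 1 0
    & g^-1 1 1 = g 0 0].
Proof.
move=> dg; pose a : 'M[R]_2 := \matrix_(i, j)
  (if i == j then if i == 0 then g 1 1 else g 0 0 else - g i j).
have ag : g * a = 1.
  move: dg; rewrite det2 => dg.
  by apply: mx2_eq; rewrite mulmx2E !mxE /= ?mulr1n ?mulr0n -?dg; ring.
have gU : g \is a GRing.unit by rewrite unitmxE dg unitr1.
have -> : g^-1 = a by apply: (mulrI gU); rewrite divrr.
by rewrite !mxE.
Qed.

Lemma mobiusN g q : mobius (- g) q = mobius g q.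
Proof.
have denN : mobius_den (- g) q = mobius_den g q by rewrite /mobius_den !mxE; ring.
by rewrite !mobiusE denN !det2 !mxE; congr (_ / _, _ / _); ring.
Qed.

(** The formula for the imaginary part of the image, followed by the imaginary and the real part of
    a q + b = w (c q + d). *)
Lemma mobius_entries g q : \det g = 1 -> half_plane q ->
  let p := g 1 0 * q.1 + g 1 1 in let r := g 1 0 * q.2 in
  let w := mobius g q in
  [/\ p ^+ 2 + r ^+ 2 = q.2 / w.2,
      g 0 0 * q.2 = w.1 * r + w.2 * p &
      g 0 0 * q.1 + g 0 1 = w.1 * p - w.2 * r].
Proof.
move=> dg q0 p r w.
have := @mobius_den_gt0 R g q _ q0; rewrite dg oner_eq0 => /(_ isT)/lt0r_neq0.
have /lt0r_neq0 : 0 < q.2 by [].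
move=> y0 n0; split.
- by rewrite /w mobiusE dg mul1r /= invf_div mulrC divfK.
- by move: n0; rewrite /w mobiusE det2 /p /r /mobius_den /= => n0; field.
- by move: n0; rewrite /w mobiusE det2 /p /r /mobius_den /= => n0; field.
Qed.

(** The height of [q] is at most 4 times that of its image, hence |c q + d| <= 2. This bounds c and
    d, and [mobius_entries] then bounds a and b; [C] sums the bounds for c, d, a, b in this
    order. *)
Lemma mobius_entry_bound g q L m : \det g = 1 -> 0 < m ->
  m <= q.2 -> `|q.1| <= L -> q.2 <= L -> m <= (mobius g q).2 ->
  `|(mobius g q).1| <= L -> (mobius g q).2 <= L -> q.2 <= 4 * m ->
  let C := 2 / m + (2 + 2 / m * L) + 4 * L / m + (4 * L + 4 * L / m * L) in
  forall i j, `|g i j| <= C.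
Proof.
move=> dg m0 mq q1L q2L mw w1L w2L Lm C.
have q0 : half_plane q by apply: lt_le_trans mq.
have [e1 e2 e3] := mobius_entries dg q0; move: e1 e2 e3 mw w1L w2L.
move: (mobius g q) => w.
set p := _ + g 1 1; set r := g 1 0 * _ => e1 e2 e3 mw w1L w2L.
have L0 : 0 < L by apply: lt_le_trans m0 (le_trans mq q2L).
have pr4 : p ^+ 2 + r ^+ 2 <= 4.
  rewrite e1 ler_pdivrMr; last exact: lt_le_trans mw.
  by apply: le_trans Lm _; rewrite ler_pM2l.
have p2 : `|p| <= 2.
  by rewrite -(@ler_pXn2r _ 2)// ?nnegrE// real_normK ?num_real; have := sqr_ge0 r; nra.
have r2 : `|r| <= 2.
  by rewrite -(@ler_pXn2r _ 2)// ?nnegrE// real_normK ?num_real; have := sqr_ge0 p; nra.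
have divm (x y k : R) : x * q.2 = y -> `|y| <= k -> `|x| <= k / m.
  move=> <-; rewrite normrM => xk; rewrite ler_pdivlMr//; apply: le_trans xk.
  by rewrite ler_wpM2l// (le_trans mq)// ler_norm.
have c1 : `|g 1 0| <= 2 / m by apply: divm r2.
have d1 : `|g 1 1| <= 2 + 2 / m * L.
  rewrite (_ : g 1 1 = p - g 1 0 * q.1); last by rewrite /p; ring.
  by apply: le_trans (ler_normB _ _) _; rewrite normrM lerD// ler_pM.
have wb (x y : R) : `|x| <= 2 -> `|y| <= 2 -> `|w.1 * x| + `|w.2 * y| <= 4 * L.
  move=> x2 y2; rewrite !normrM (_ : 4 * L = L * 2 + L * 2); last by ring.
  apply: lerD; apply: ler_pM => //; rewrite ger0_norm//.
  by apply: le_trans mw; exact: ltW.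
have a1 : `|g 0 0| <= 4 * L / m.
  by apply: divm e2 _; apply: le_trans (ler_normD _ _) (wb _ _ _ _).
have b1 : `|g 0 1| <= 4 * L + 4 * L / m * L.
  rewrite (_ : g 0 1 = (w.1 * p - w.2 * r) - g 0 0 * q.1); last by rewrite -e3; ring.
  apply: le_trans (ler_normB _ _) _; rewrite [X in _ + X]normrM lerD//.
    by apply: le_trans (ler_normB _ _) (wb _ _ _ _).
  by rewrite ler_pM.
have Lm0 : 0 <= L / m by rewrite divr_ge0// ltW.
have LLm0 : 0 <= L / m * L by rewrite mulr_ge0// ltW.
have m20 : 0 <= 1 / m by rewrite divr_ge0// ltW.
move=> i j.
by case: (ord2_cases i) => ->; case: (ord2_cases j) => ->; rewrite /C;
 apply: le_trans (_ : _ <= _) _; try eassumption; lra.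
Qed.

Variable Gamma : fuchsian_group R.

Lemma fuchsian_sep : exists2 d : R, 0 < d & forall g, Gamma g ->
  (forall i j, `|g i j - (1 : 'M[R]_2) i j| < d) -> g = 1.
Proof.
have /nbhs_ballP[d /= d0 dP] := @fuchsian_discrete _ Gamma.
exists d => // g Gg gd; apply: (dP g) => //; split => // i j.
by rewrite /ball /= distrC.
Qed.

(** Discreteness carried from 1 to bounded sets, through [g^-1 * h = 1 - g^-1 * (g - h)]; the
    entries of [g^-1] are those of [g] up to sign and position. *)
Lemma fuchsian_eq (C : R) : exists2 d : R, 0 < d & forall g h,
  Gamma g -> Gamma h -> (forall i j, `|g i j| <= C) ->
  (forall i j, `|g i j - h i j| < d) -> g = h.
Proof.
have [d d0 dP] := fuchsian_sep.
pose e := d / (2 * (`|C| + 1)).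
have C0 : 0 < 2 * (`|C| + 1) by rewrite mulr_gt0// ltr_wpDl.
exists e; first by rewrite divr_gt0.
move=> g h Gg Gh gC ghe.
have dg := fuchsian_det Gg.
have gU : g \is a GRing.unit by rewrite unitmxE dg unitr1.
suff gh1 : g^-1 * h = 1 by rewrite -[RHS]mul1r -(divrr gU) -mulrA gh1 mulr1.
have gC' i j : `|g i j| <= `|C| + 1.
  by apply: le_trans (gC i j) (le_trans (ler_norm _) _); rewrite lerDl.
apply: dP; first by apply: fuchsianM => //; exact: fuchsianV.
have -> : g^-1 * h = 1 - g^-1 * (g - h) by rewrite mulrBr mulVr// opprB addrC subrK.
have bnd (a b x y : R) : `|a| <= `|C| + 1 -> `|b| <= `|C| + 1 ->
    `|x| < e -> `|y| < e -> `|a * x + b * y| < d.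
  move=> aC bC xe ye; apply: le_lt_trans (ler_normD _ _) _.
  rewrite !normrM (_ : d = (`|C| + 1) * e + (`|C| + 1) * e); last first.
    by rewrite /e; field; rewrite gt_eqF// ltr_wpDl.
  have C1 : 0 < `|C| + 1 by rewrite ltr_wpDl.
  apply: ltrD.
    by apply: le_lt_trans (ler_wpM2r (normr_ge0 x) aC) _; rewrite ltr_pM2l.
  by apply: le_lt_trans (ler_wpM2r (normr_ge0 y) bC) _; rewrite ltr_pM2l.
move=> i j; rewrite (_ : _ - _ = - (g^-1 * (g - h)) i j); last first.
  by move: (g^-1 * _) => X; rewrite !mxE; ring.
rewrite normrN mulmx2E.
have [i00 i01 i10 i11] := inv_mx2 dg.
by case: (ord2_cases i) => ->; rewrite ?(i00, i01, i10, i11) !mxE; apply: bnd; rewrite ?normrN.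
Qed.

(** Otherwise, at every scale some element moves a point near [q0] to a different nearby point. The
    entries of these elements lie in a compact box, so by discreteness one element occurs at all
    scales; it fixes [q0] by continuity, hence is 1 or -1 by freeness, and moves nothing. *)
Lemma fuchsian_locally_free q0 : half_plane q0 ->
  exists2 e : R, 0 < e & forall g q q', Gamma g -> half_plane q ->
    ball q0 e q -> ball q0 e q' -> mobius g q = q' -> q = q'.
Proof.
move=> q0H; apply: contrapT => noe.
pose S (e : R) := [set g : 'M[R]_2 | Gamma g /\ exists q q', [/\ half_plane q,
  ball q0 e q, ball q0 e q', mobius g q = q' & q <> q']].
have SE e : 0 < e -> exists g, S e g.
  move=> e0; apply: contrapT => /forallNP nS; apply: noe; exists e => // g q q' Gg qH b1 b2 e1.
  by apply: contrapT => ne; apply: (nS g); split=> //; exists q, q'.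
pose m := q0.2 / 2; have m0 : 0 < m by rewrite divr_gt0.
pose L := `|q0.1| + m + q0.2.
have q0E : q0.2 = m * 2 by rewrite /m divfK.
have ballE q e : ball q0 e q -> `|q0.1 - q.1| < e /\ `|q0.2 - q.2| < e by case.
have inb q e : e <= m -> ball q0 e q -> [/\ m <= q.2, q.2 <= 3 * m, `|q.1| <= L & q.2 <= L].
  move=> em /ballE[]; rewrite !ltr_norml => /andP[a1 a2] /andP[b1 b2].
  have := ler_norm q0.1; have := ler_norm (- q0.1); rewrite normrN => n1 n2.
  have nn := normr_ge0 q0.1.
  by split; rewrite /L ?ler_norml; rewrite ?q0E in b1 b2 *; [..|apply/andP; split|]; lra.
pose C := 2 / m + (2 + 2 / m * L) + 4 * L / m + (4 * L + 4 * L / m * L).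
have SC e g : e <= m -> S e g -> forall i j, `|g i j| <= C.
  move=> em [Gg [q [q' [qH /(inb _ _ em)[h1 h2 h3 h4] /(inb _ _ em)[k1 k2 k3 k4] gq _]]]].
  rewrite -gq in k1 k2 k3 k4.
  apply: (mobius_entry_bound (fuchsian_det Gg) m0 h1) => //.
  by apply: le_trans h2 _; rewrite ler_pM2r// ler_nat.
have [d d0 dP] := fuchsian_eq C.
(* A matrix as a point of a product of four lines, in which boxes are compact. *)
pose code (g : 'M[R]_2) := (g 0 0, g 0 1, (g 1 0, g 1 1)).
pose I := `[- C, C]%classic : set R.
have cI : compact I by exact: segment_compact.
have Smono e e' g : e <= e' -> S e g -> S e' g.
  move=> ee [Gg [q [q' [qH b1 b2 gq qq']]]]; split=> //; exists q, q'.
  by split => //; apply: le_ball ee _ _.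
have Sq0 g : (forall e, 0 < e -> e <= m -> S e g) -> mobius g q0 = q0.
  move=> Sg; have [Gg _] := Sg m m0 (lexx _).
  have cg : {for q0, continuous (mobius g)}.
    apply: (@mobius_continuous R _ (fun=> g) id) => //; last first.
      by rewrite (fuchsian_det Gg) oner_eq0.
    by move=> i j; exact: cst_continuous.
  apply: contrapT => /eqP; rewrite -subr_eq0 -normr_gt0.
  set eta := `|_| => eta0.
  have eta20 : 0 < eta / 2 by rewrite divr_gt0.
  have : \forall q \near q0, ball (mobius g q0) (eta / 2) (mobius g q).
    by apply: cg; exact: nbhsx_ballx.
  move=> /nbhs_ballP[dl /= dl0 dlP].
  pose e := Num.min m (Num.min dl (eta / 2)).
  have e0 : 0 < e by rewrite !lt_min m0 dl0.
  have [em edl eeta] : [/\ e <= m, e <= dl & e <= eta / 2].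
    by rewrite /e !ge_min !lexx !orbT.
  have [_ [q [q' [qH /(le_ball edl)/dlP gq /(le_ball eeta) qq' gqE _]]]] := Sg e e0 em.
  move: gq; rewrite gqE => gq.
  have := ball_triangle gq (ball_sym qq'); rewrite -splitr.
  by rewrite -ball_normE /= ltxx.
(* By [fuchsian_eq], elements of [S m] with codes within [d / 2] of [x] coincide; if [x] were
   approached at every scale, a single element would belong to all [S e]. *)
have main x : exists2 e, 0 < e & forall g, S e g -> ~ ball x (d / 2) (code g).
  apply: contrapT => no.
  have Sx e : 0 < e -> exists2 g, S e g & ball x (d / 2) (code g).
    move=> e0; apply: contrapT => h; apply: no; exists e => // g Sg xg.
    by apply: h; exists g.
  have [g0 Sg0 xg0] := Sx m m0.
  have Sall e : 0 < e -> e <= m -> S e g0.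
    move=> e0 em; have [g Sg xg] := Sx e e0.
    suff -> : g0 = g by [].
    apply: dP; [exact: Sg0.1|exact: Sg.1|exact: SC Sg0|].
    have : ball (code g0) d (code g).
      by rewrite (splitr d); apply: ball_triangle (ball_sym xg0) xg.
    move=> [[/= a00 a01] [/= a10 a11]] i j.
    by case: (ord2_cases i) => ->; case: (ord2_cases j) => ->.
  have := fuchsian_free Sg0.1 q0H (Sq0 _ Sall).
  move: Sg0 => [_ [q [q' [_ _ _ gq ne]]]] gE; apply: ne; rewrite -gq.
  by case: gE => ->; rewrite ?mobiusN mobius1.
have := compact_setX (compact_setX cI cI) (compact_setX cI cI).
move/compact_near_coveringP.
move=> /(_ R (0 : R)^'+ (fun e x => forall g, S e g -> code g <> x) _).
case.
  move=> x _; have [e e0 eP] := main x.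
  exists (ball x (d / 2), [set e1 | e1 <= e]) => /=.
    by split; [apply: nbhsx_ballx; rewrite divr_gt0|exact: nbhs_right_le].
  by move=> [x' e1] /= [bx e1e] g Sg gx'; apply: (eP g); [exact: Smono Sg|rewrite gx'].
move=> e1 /= e10 e1P.
pose e := Num.min m (e1 / 2).
have e0 : 0 < e by rewrite lt_min m0 divr_gt0.
have [g Sg] := SE e e0.
have em : e <= m by rewrite ge_min lexx.
have gC := SC _ _ em Sg.
apply: (e1P e) (Sg) _ => //.
- by rewrite /ball /= sub0r normrN gtr0_norm// gt_min; apply/orP; right; move: e10 => /= ?; lra.
- by split; split; rewrite /I /= in_itv /= -ler_norml.
Qed.

Local Notation H := (set_type (@half_plane R)).

Lemma surface_piP (u v : H) : surface_pi Gamma u = surface_pi Gamma v <->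
  exists2 g, Gamma g & mobius g (val u) = val v.
Proof. by split=> [/eqmodP/asboolP//|h]; apply/eqmodP/asboolP. Qed.

(** The default value [u] is never taken when [g] is in [Gamma], by [half_plane_actE]. *)
Definition half_plane_act g (u : H) : H := insubd u (mobius g (val u)).

Lemma half_plane_actE g u : Gamma g ->
  val (half_plane_act g u) = mobius g (val u).
Proof.
move=> Gg; rewrite /half_plane_act insubdK//; apply/mem_set.
by apply: mobius_half_plane; rewrite ?(fuchsian_det Gg)//; exact: set_valP.
Qed.

Lemma half_plane_act_continuous g : Gamma g -> continuous (half_plane_act g).
Proof.
move=> Gg; apply: (@continuous_comp_initial _ _ _ set_val).
rewrite (_ : _ \o _ = (mobius g) \o val); last first.
  by apply/funext => u /=; rewrite -half_plane_actE.
move=> u; apply: continuous_comp; first exact: initial_continuous.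
apply: (@mobius_continuous R _ (fun=> g) id) => //; last exact: set_valP.
  by move=> i j; exact: cst_continuous.
by rewrite (fuchsian_det Gg) oner_eq0.
Qed.

Lemma half_plane_hausdorff : hausdorff_space H.
Proof.
rewrite open_hausdorff => u v uv.
have hR : hausdorff_space (R * R)%type := @norm_hausdorff _ _.
move: hR; rewrite open_hausdorff => /(_ (val u) (val v)).
rewrite (inj_eq val_inj) => /(_ uv)[[A B] /= [uA vB] [oA oB AB]].
exists (val @^-1` A, val @^-1` B) => /=.
  by split; apply/mem_set; [move/set_mem: uA|move/set_mem: vB].
split.
- by apply: open_comp => // w _; exact: initial_continuous.
- by apply: open_comp => // w _; exact: initial_continuous.
- by rewrite -preimage_setI (eqP AB) preimage_set0.
Qed.

(** Local injectivity is [fuchsian_locally_free]; openness holds because the saturation of an open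
    set is the union of its translates. *)
Lemma surface_covering : orbit_covering
  [set a | exists2 g, Gamma g & a = half_plane_act g] (surface_pi Gamma).
Proof.
split.
- by move=> b; exists (repr b); rewrite /surface_pi reprK.
- move=> U oU.
  suff: open (surface_pi Gamma @^-1` (surface_pi Gamma @` U)) by [].
  have -> : surface_pi Gamma @^-1` (surface_pi Gamma @` U) =
      \bigcup_(g in [set g | Gamma g]) (half_plane_act g @^-1` U).
    apply/seteqP; split => [u [v Uv /esym/surface_piP[g Gg gE]]|u [g /= Gg Ug]].
      exists g => //=; rewrite (_ : half_plane_act g u = v)//; apply/val_inj.
      by rewrite -gE half_plane_actE.
    exists (half_plane_act g u) => //; apply/esym/surface_piP; exists g => //.
    by rewrite half_plane_actE.
  apply: bigcup_open => g Gg; apply: open_comp => // u _.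
  exact: half_plane_act_continuous.
- move=> _ [g Gg ->]; split; first exact: half_plane_act_continuous.
  by move=> u; apply/esym/surface_piP; exists g => //; rewrite half_plane_actE.
- move=> u v /surface_piP[g Gg gE]; exists (half_plane_act g); first by exists g.
  by apply/val_inj; rewrite -gE half_plane_actE.
- move=> u; have [e e0 eP] := fuchsian_locally_free (set_valP u).
  exists (val @^-1` (ball (val u) e)); split.
  + apply: open_comp => [w _|]; [exact: initial_continuous|exact: ball_open].
  + exact: ballxx.
  + move=> v w /set_mem /= bv /set_mem /= bw /surface_piP[g Gg gE].
    by apply/val_inj; apply: (eP g) => //; exact: set_valP.
Qed.

End Fuchsian.

(** * Continuous dependence of solutions *)

Section Curves.
Variable R : realType.

Lemma is_derive_cvg (V W : normedModType R) (f : V -> W) a v df :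
  is_derive a v f df ->
  (fun h => h^-1 *: (f (h *: v + a) - f a)) @ 0^' --> df.
Proof. by case=> fd <-; exact: fd. Qed.

Lemma cvg_is_derive (V W : normedModType R) (f : V -> W) a v df :
  (fun h => h^-1 *: (f (h *: v + a) - f a)) @ 0^' --> df ->
  is_derive a v f df.
Proof.
by move=> fd; apply: DeriveDef; [apply/cvg_ex; exists df|exact: cvg_lim].
Qed.

Lemma is_derive_fst (w : R -> R * R) t d :
  is_derive t (1 : R) w d -> is_derive t (1 : R) (fun s => (w s).1) d.1.
Proof.
move=> /is_derive_cvg wd; apply: cvg_is_derive.
exact: (cvg_comp _ _ wd (@cvg_fst _ _ (nbhs d.1) (nbhs d.2) _)).
Qed.

Lemma is_derive_snd (w : R -> R * R) t d :
  is_derive t (1 : R) w d -> is_derive t (1 : R) (fun s => (w s).2) d.2.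
Proof.
move=> /is_derive_cvg wd; apply: cvg_is_derive.
exact: (cvg_comp _ _ wd (@cvg_snd _ _ (nbhs d.1) (nbhs d.2) _)).
Qed.

Lemma is_derive_continuous (W : normedModType R) (w : R -> W) t d :
  is_derive t (1 : R) w d -> {for t, continuous w}.
Proof.
move=> [wd _]; apply: differentiable_continuous.
exact/derivable1_diffP.
Qed.

Lemma MVT_between (f df : R -> R) a b :
  (forall t, is_derive t (1 : R) f (df t)) ->
  exists2 c, `|c - a| <= `|b - a| & f b - f a = df c * (b - a).
Proof.
move=> fd.
have fc (x y : R) : {within `[x, y], continuous f}.
  by apply: continuous_subspaceT => t; exact: is_derive_continuous (fd t).
have [ab|/ltW ba] := leP a b.
  have [c /itvP cab e] := MVT_segment ab (fun t _ => fd t) (fc a b).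
  by exists c => //; rewrite !ger0_norm ?subr_ge0 ?lerD2r// ?cab.
have [c /itvP cab e] := MVT_segment ba (fun t _ => fd t) (fc b a).
exists c; last by rewrite -opprB e -mulrN opprB.
by rewrite !ler0_norm ?subr_le0 ?lerN2 ?lerD2r// ?cab.
Qed.

(** The norm of a pair is the maximum over its coordinates, so the scalar mean value theorem may be
    applied to each coordinate with its own intermediate point. *)
Lemma mean_value_ineq (w dw : R -> R * R) a b v e :
  (forall t, is_derive t (1 : R) w (dw t)) ->
  (forall t, `|t - a| <= `|b - a| -> `|dw t - v| <= e) ->
  `|w b - w a - (b - a) *: v| <= e * `|b - a|.
Proof.
move=> wd dwe.
have [c1 c1P e1] := MVT_between a b (fun t => is_derive_fst (wd t)).
have [c2 c2P e2] := MVT_between a b (fun t => is_derive_snd (wd t)).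
have := dwe _ c1P; have := dwe _ c2P; rewrite !prod_normE /= !ge_max.
move=> /andP[_ h2] /andP[h1 _]; rewrite e1 e2.
by apply/andP; split; rewrite [_ *: _]mulrC -mulrBl normrM ler_wpM2r.
Qed.

(** The hyperbolic speed is at most [B], so the logarithm of the height is [B]-Lipschitz in time. *)
Lemma growth_bound (z dz : R -> R * R) B :
  (forall t, half_plane (z t)) -> (forall t, is_derive t (1 : R) z (dz t)) ->
  (forall t, `|dz t| <= B * (z t).2) ->
  forall t, (z 0).2 * expR (- (B * `|t|)) <= (z t).2 <= (z 0).2 * expR (B * `|t|).
Proof.
move=> zH zd zB t.
have lnd s : is_derive s (1 : R) (@ln R \o (fun s => (z s).2)) ((z s).2^-1 * (dz s).2).
  by apply: is_derive1_comp; [exact: is_derive1_ln (zH s)|exact: is_derive_snd (zd s)].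
have [c _ /=] := MVT_between 0 t lnd; rewrite subr0 => e.
have : `|ln (z t).2 - ln (z 0).2| <= B * `|t|.
  rewrite e normrM ler_wpM2r// normrM gtr0_norm ?invr_gt0; last exact: zH.
  rewrite mulrC ler_pdivrMr; last exact: zH.
  by apply: le_trans (zB c); rewrite prod_normE /= le_max lexx orbT.
rewrite ler_norml => /andP[h1 h2].
rewrite -[X in X * expR (- _)](lnK (zH 0)) -[X in _ && (_ <= X * _)](lnK (zH 0)).
rewrite -[(z t).2](lnK (zH t)) -!expRD !ler_expR.
by apply/andP; split; lra.
Qed.

End Curves.

Section Flow.
Variables (R : realType) (V : R -> R * R -> R * R) (Y : R -> R -> R * R -> R * R).
Variable B : R.
Hypothesis Vc : forall t q, half_plane q ->
  {for (t, q), continuous (fun u : R * (R * R) => V u.1 u.2)}.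
Hypothesis VB : forall t q, half_plane q -> `|V t q| <= B * q.2.
Hypothesis VY : solution_map V Y.

Lemma flow_half_plane t q : half_plane q -> half_plane (Y t 0 q).
Proof. by move=> qH; have [sY _ _] := VY 0 qH; have [] := sY t. Qed.

Lemma flow_derive t q : half_plane q ->
  is_derive t (1 : R) (fun s => Y s 0 q) (V t (Y t 0 q)).
Proof. by move=> qH; have [sY _ _] := VY 0 qH; have [] := sY t. Qed.

Lemma flow0 q : half_plane q -> Y 0 0 q = q.
Proof. by move=> qH; have [] := VY 0 qH. Qed.

Lemma flow_B_ge0 : 0 <= B.
Proof.
have h : half_plane ((0, 1) : R * R) by rewrite /half_plane /=.
by have := VB 0 h; rewrite /= mulr1; apply: le_trans.
Qed.

Lemma flow_growth t q : half_plane q ->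
  q.2 * expR (- (B * `|t|)) <= (Y t 0 q).2 <= q.2 * expR (B * `|t|).
Proof.
move=> qH; have := @growth_bound _ (fun s => Y s 0 q) (fun s => V s (Y s 0 q)) B.
rewrite flow0//; apply => s.
- exact: flow_half_plane.
- exact: flow_derive.
- by apply: VB; exact: flow_half_plane.
Qed.

(** Over bounded times [flow_growth] bounds the height, uniformly in the starting point near [q0],
    and [VB] bounds the speed by the height. *)
Lemma flow_lip t q0 r : exists2 L : R, 0 < L & forall q s, half_plane q ->
  ball q0 1 q -> `|s - t| <= r -> `|Y s 0 q - Y t 0 q| <= L * `|s - t|.
Proof.
pose L := B * ((q0.2 + 1) * expR (B * (`|t| + r))) + 1.
have B0 := flow_B_ge0.
have Lb q : half_plane q -> ball q0 1 q -> forall c, `|c - t| <= r ->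
    `|V c (Y c 0 q)| <= L.
  move=> qH [_ /=]; rewrite /ball/= ltr_norml => /andP[b1 b2] c ct.
  apply: le_trans (VB _ (flow_half_plane _ qH)) _.
  apply: ler_wpDr => //; rewrite ler_wpM2l//.
  have /andP[_] := flow_growth c qH; move/le_trans; apply.
  apply: ler_pM; rewrite ?expR_ge0//; first exact: ltW.
    lra.
  rewrite ler_expR ler_wpM2l// -[c](subrK t) addrC.
  by apply: le_trans (ler_normD _ _) _; rewrite lerD2l.
(* If [q0.2 + 1] is negative, the unit ball around [q0] misses the half-plane and any constant
   serves. *)
have [q01|q01] := leP 0 (q0.2 + 1); last first.
  exists 1 => // q s qH [_ /=]; rewrite /ball/= ltr_norml => /andP[b1 b2].
  have : 0 < q.2 by []; lra.
exists L; first by rewrite ltr_wpDl// mulr_ge0// mulr_ge0// expR_ge0.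
move=> q s qH bq st.
have := @mean_value_ineq R (fun s => Y s 0 q) (fun s => V s (Y s 0 q)) t s 0 L.
rewrite scaler0 subr0; apply => c; first exact: flow_derive.
by move=> cs; rewrite subr0; apply: Lb => //; exact: le_trans cs st.
Qed.

Lemma half_plane_near (q0 : R * R) : half_plane q0 ->
  \forall q \near q0, half_plane q /\ ball q0 1 q /\ q0.2 / 2 <= q.2.
Proof.
move=> q0H; have m0 : 0 < q0.2 / 2 by rewrite divr_gt0.
have b1 := @nbhsx_ballx _ _ q0 _ (@ltr01 R).
have b2 := nbhsx_ballx q0 _ m0; apply: (filterS2 _ _ b1 b2) => q {}b1 [_ /=].
rewrite /ball /= ltr_norml => /andP[_ h].
split; last by split=> //; lra.
by rewrite /half_plane /=; lra.
Qed.

(** The a priori bounds confine the images to a closed rectangle above the real axis; an ultrafilter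
    on a compact set converges. *)
Lemma flow_ultra_cvg (U : set_system (R * R)) q0 t : UltraFilter U ->
  U --> q0 -> half_plane q0 ->
  exists2 l, half_plane l & Y t 0 q @[q --> U] --> l.
Proof.
move=> UU Uq0 q0H.
have PU : ProperFilter U by exact: ultra_proper.
have [L L0 LP] := flow_lip 0 q0 `|t|.
pose m := q0.2 / 2; have m0 : 0 < m by rewrite divr_gt0.
pose M := `|q0.1| + 1 + L * `|t|.
pose a := m * expR (- (B * `|t|)); pose b := (q0.2 + 1) * expR (B * `|t|).
pose K := (`[- M, M] `*` `[a, b])%classic : set (R * R).
have cK : compact K by apply: compact_setX; exact: segment_compact.
have UK : (Y t 0 q @[q --> U]) K.
  have UB : U [set q | half_plane q /\ ball q0 1 q /\ q0.2 / 2 <= q.2].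
    by apply: Uq0; exact: half_plane_near.
  suff: U [set q | K (Y t 0 q)] by [].
  apply: filterS UB => q [qH [bq qm]].
  have := LP q t qH bq; rewrite subr0 => /(_ (lexx _)); rewrite flow0// => tb.
  have /andP[g1 g2] := flow_growth t qH.
  move: bq => [/=]; rewrite /ball /= !ltr_norml => /andP[b1 b2] /andP[b3 b4].
  split => /=; rewrite in_itv /=; last first.
    apply/andP; split.
      by apply: le_trans g1; rewrite ler_wpM2r// expR_ge0.
    by apply: le_trans g2 _; rewrite ler_wpM2r ?expR_ge0//; lra.
  rewrite -ler_norml -[(Y t 0 q).1](subrK q.1).
  apply: le_trans (ler_normD _ _) _; rewrite addrC; apply: lerD.
    rewrite -[q.1](subrK q0.1) addrC; apply: le_trans (ler_normD _ _) _.
    by rewrite lerD2l ler_norml; apply/andP; split; lra.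
  by apply: le_trans tb; rewrite [leRHS]prod_normE /= le_max lexx.
have [p [Kp clp]] := cK _ _ UK.
have a0 : 0 < a by rewrite mulr_gt0// expR_gt0.
exists p; first by move: Kp => [_ /=]; rewrite in_itv /= => /andP[ap _]; exact: lt_le_trans ap.
move=> W nW; have [//|UnW] := in_ultra_setVsetC (Y t 0 @^-1` W) UU.
have [x [nWx Wx]] := clp (~` W) W UnW nW; by [].
Qed.

(* V is only continuous, so no Gronwall estimate is available. Instead,       *)
(* pointwise limits of solutions along an ultrafilter are solutions, and      *)
(* uniqueness identifies the limit.                                           *)
Lemma flow_ultra_derive (U : set_system (R * R)) q0 (y : R -> R * R) t :
  UltraFilter U -> U --> q0 -> half_plane q0 ->
  (forall t, half_plane (y t)) ->
  (forall t, Y t 0 q @[q --> U] --> y t) ->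
  is_derive t (1 : R) y (V t (y t)).
Proof.
move=> UU Uq0 q0H yH yP.
have PU : ProperFilter U by exact: ultra_proper.
have FU : Filter U := @filter_filter _ _ PU.
have [L L0 LP] := flow_lip t q0 1.
have UB : U [set q | half_plane q /\ ball q0 1 q /\ q0.2 / 2 <= q.2].
  by apply: Uq0; exact: half_plane_near.
apply: cvg_is_derive; apply/cvgrPdist_le => e e0.
have : \forall u \near (t, y t), `|V t (y t) - V u.1 u.2| < e.
  by have /cvgrPdist_lt := @Vc t (y t) (yH t); apply.
move=> /nbhs_ballP[eta /= eta0 etaP].
(* The bound 1 is the range of [flow_lip]; [eta / 2 / L] keeps each trajectory within [eta / 2] of
   its position at time [t]. *)
pose d := Num.min 1 (Num.min eta (eta / 2 / L)).
have d0 : 0 < d by rewrite !lt_min ltr01 eta0 !divr_gt0.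
have [d1 deta dL] : [/\ d <= 1, d <= eta & d <= eta / 2 / L].
  by rewrite /d !ge_min !lexx !orbT.
(* The estimate holds for the approximating solutions and is a closed condition, so it passes to the
   limit along [U]. *)
have key s : `|s - t| < d -> `|y s - y t - (s - t) *: V t (y t)| <= e * `|s - t|.
  move=> st.
  have cl : closed [set x : R | x <= e * `|s - t|] by exact: closed_le.
  have cst_cvg := @cvg_cst _ ((s - t) *: V t (y t)) _ U FU.
  have lim := cvg_norm (cvgB (cvgB (yP s) (yP t)) cst_cvg).
  have lePU : U [set q | `|Y s 0 q - Y t 0 q - (s - t) *: V t (y t)| <= e * `|s - t|].
    have Unear : U [set q | `|y t - Y t 0 q| < eta / 2].
      have e2 : 0 < eta / 2 by rewrite divr_gt0.
      by move/cvgrPdist_lt: (yP t) => /(_ _ e2).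
    apply: (filterS2 _ _ UB Unear) => q [qH [bq _]] /= yq.
    apply: (@mean_value_ineq R (fun s => Y s 0 q) (fun s => V s (Y s 0 q))).
      by move=> c; exact: flow_derive.
    move=> c cs; have ctd : `|c - t| < d by apply: le_lt_trans st.
    rewrite distrC; apply/ltW/(etaP (c, Y c 0 q)); split => /=.
      by rewrite /ball /= distrC; apply: lt_le_trans deta.
    rewrite -ball_normE /=.
    rewrite (splitr eta) -(subrKA (Y t 0 q)); apply: le_lt_trans (ler_normD _ _) _.
    apply: ltr_leD => //; rewrite distrC.
    apply: le_trans (LP q c qH bq (le_trans (ltW ctd) d1)) _.
    rewrite mulrC -ler_pdivlMr//; exact: le_trans (ltW ctd) dL.
  exact: (@closed_cvg _ _ U PU _ _ cl lePU _ (lim FU FU FU)).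
near=> h.
have h0 : h != 0 by near: h; exact: nbhs_dnbhs_neq.
have hd : `|h| < d.
  by near: h; apply: dnbhs0_lt.
have := key (h + t); rewrite addrK => /(_ hd) k.
rewrite [X in y (X + t)](_ : _ = h); last by rewrite /GRing.scale /= mulr1.
rewrite -[V t (y t)]scale1r -(mulVf h0) -scalerA -scalerBr normrZ distrC normfV.
by rewrite ler_pdivrMl ?normr_gt0// mulrC.
Unshelve. all: by end_near. Qed.

(** If continuity failed, some ultrafilter tending to [q0] would live on points whose images avoid
    [W]. The limit of their trajectories is a solution through [q0], so by uniqueness their images
    tend to [Y t 0 q0], which has [W] as a neighbourhood. *)
Lemma flow_continuous t q0 : half_plane q0 -> {for q0, continuous (Y t 0)}.
Proof.
move=> q0H W nW; apply: contrapT => nWq.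
have PF : ProperFilter (within (~` (Y t 0 @^-1` W)) (nbhs q0)).
  split; last exact: within_filter.
  move=> h; apply: nWq; suff: nbhs q0 (Y t 0 @^-1` W) by [].
  have {}h : \forall q \near q0, ~ W (Y t 0 q) -> False by [].
  by near=> q => /=; apply: contrapT; near: q.
have [U [UU FU]] := ultraFilterLemma PF.
have Uq0 : U --> q0.
  move=> A nA; apply: FU; rewrite /within /=.
  by near=> q => _; near: q.
have lims s : exists l, half_plane l /\ (Y s 0 q @[q --> U] --> l).
  by have [l lH lP] := flow_ultra_cvg s UU Uq0 q0H; exists l.
have [y yP] := choice lims.
have PU : ProperFilter U by exact: ultra_proper.
have [_ _ uniq] := VY 0 q0H.
have yE : y 0 = q0.
  have hR : hausdorff_space (R * R)%type := @norm_hausdorff _ _.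
  apply: (@cvg_unique _ hR U) => //.
  have := (yP 0).2; apply: cvg_trans => A nA.
  have UB : U [set q | half_plane q /\ ball q0 1 q /\ q0.2 / 2 <= q.2].
    by apply: Uq0; exact: half_plane_near.
  have {}nA : U [set q | A (Y 0 0 q)] by [].
  by apply: (filterS2 _ _ UB nA) => q [qH _] /=; rewrite flow0.
have sy : solution V y.
  move=> s; split; first exact: (yP s).1.
  have yH r : half_plane (y r) by exact: (yP r).1.
  have yl r : Y r 0 q @[q --> U] --> y r by exact: (yP r).2.
  exact: flow_ultra_derive UU Uq0 q0H yH yl.
have := uniq y sy yE t => ytE.
have := (yP t).2; rewrite ytE => /(_ W nW) UW0.
have UW : U (Y t 0 @^-1` W) by [].
have UnW : U (~` (Y t 0 @^-1` W)) by apply: FU; exact: withinT.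
by have [q [qW]] := filter_ex (filterI UW UnW).
Unshelve. all: by end_near. Qed.

Lemma flow_jointly_continuous t q0 : half_plane q0 ->
  {for (t, q0), continuous (fun u : R * (R * R) => Y u.1 0 u.2)}.
Proof.
move=> q0H; apply/cvgrPdist_lt => e e0 /=.
have [L L0 LP] := flow_lip t q0 1.
have e20 : 0 < e / 2 by rewrite divr_gt0.
have n1 : \forall q \near q0, `|Y t 0 q0 - Y t 0 q| < e / 2.
  by have /cvgrPdist_lt := @flow_continuous t q0 q0H; apply.
pose d := Num.min 1 (e / 2 / L).
have d0 : 0 < d by rewrite lt_min ltr01 divr_gt0.
exists (ball t d, [set q | `|Y t 0 q0 - Y t 0 q| < e / 2] `&`
   [set q | half_plane q /\ ball q0 1 q /\ q0.2 / 2 <= q.2]) => /=.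
  split; first exact: nbhsx_ballx.
  by apply: filterI => //; exact: half_plane_near.
move=> [s q] /= [ts [tq [qH [bq _]]]].
rewrite (splitr e) -(subrKA (Y t 0 q)); apply: le_lt_trans (ler_normD _ _) _.
apply: ltr_leD => //; rewrite distrC.
have : `|s - t| < d by rewrite distrC.
rewrite lt_min => /andP[s1 sL].
apply: le_trans (LP q s qH bq (ltW s1)) _.
by rewrite mulrC -ler_pdivlMr// ltW.
Qed.

Lemma flow_inj t q q' : half_plane q -> half_plane q' ->
  Y t 0 q = Y t 0 q' -> q = q'.
Proof.
move=> qH q'H e; have pH := flow_half_plane t qH.
have [_ _ uniq] := VY t pH.
have [s1 f1 _] := VY 0 qH; have [s2 f2 _] := VY 0 q'H.
have e1 := uniq _ s1 erefl 0; have e2 := uniq _ s2 (esym e) 0.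
by rewrite -f1 -f2 e1 e2.
Qed.

End Flow.

(** * Vector fields on the surface *)

Section InvariantField.
Variables (R : realType) (Gamma : fuchsian_group R) (V : R -> R * R -> R * R).
Hypothesis Vc : forall t q, half_plane q ->
  {for (t, q), continuous (fun u : R * (R * R) => V u.1 u.2)}.
Hypothesis Vcomp : compatible Gamma V.

Lemma periodic_int T : (forall t q, half_plane q -> V (t + T) q = V t q) ->
  forall (n : int) t q, half_plane q -> V (t + T *~ n) q = V t q.
Proof.
move=> VT; have nat_case n t q : half_plane q -> V (t + T *+ n) q = V t q.
  by move=> qH; elim: n => [|n IH]; rewrite ?mulr0n ?addr0// mulrSr addrA VT.
move=> [n|n] t q qH; first by rewrite -pmulrn nat_case.
by rewrite NegzE mulrNz -pmulrn -[LHS](nat_case n.+1)// subrK.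
Qed.

(* The hyperbolic norm of V is invariant under Gamma, hence it is bounded by  *)
(* its maximum over the compact set [0, T] x D.                               *)
Lemma field_bound (D : fundamental_region Gamma) T : 0 < T ->
  (forall t q, half_plane q -> V (t + T) q = V t q) ->
  exists B, forall t q, half_plane q -> `|V t q| <= B * q.2.
Proof.
move=> T0 VT.
pose n (u : R * (R * R)) := ((V u.1 u.2).1 ^+ 2 + (V u.1 u.2).2 ^+ 2) / u.2.2 ^+ 2.
pose K := (`[0, T] `*` region D)%classic.
have cK : compact K.
  by apply: compact_setX; [exact: segment_compact|exact: region_compact].
have KH u : K u -> half_plane u.2 by case=> _ /region_half_plane.
have i1H : half_plane ((0, 1) : R * R) by rewrite /half_plane /=.
have K0 : K !=set0.
  have [g _ gD] := @region_cover _ _ D _ i1H.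
  by exists (0, mobius g (0, 1)); split => //=; rewrite in_itv /= lexx ltW.
have nc : {within K, continuous n}.
  apply: continuous_in_subspaceT => -[t q] /set_mem /KH /= qH.
  have c1 : {for (t, q), continuous (fun u : R * (R * R) => (V u.1 u.2).1)}.
    by apply: continuous_comp; [exact: Vc|exact: cvg_fst].
  have c2 : {for (t, q), continuous (fun u : R * (R * R) => (V u.1 u.2).2)}.
    by apply: continuous_comp; [exact: Vc|exact: cvg_snd].
  have c3 : {for (t, q), continuous (fun u : R * (R * R) => u.2.2)}.
    by apply: (@continuous_comp _ _ _ snd snd); exact: cvg_snd.
  have c4 : {for (t, q), continuous (fun u : R * (R * R) => (u.2.2 ^+ 2)^-1)}.
    by apply: continuousV; [rewrite sqrf_eq0 gt_eqF|exact: continuous_sqr].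
  exact: continuousM (continuousD (continuous_sqr c1) (continuous_sqr c2)) c4.
have [c Kc cmax] := compact_EVT_max K0 cK nc.
(* [M] bounds the square of the hyperbolic norm; as [M <= (M + 1) ^+ 2], the constant [M + 1] bounds
   the norm without square roots. *)
pose M := n c; exists (M + 1).
have M0 : 0 <= M by rewrite divr_ge0 ?addr_ge0 ?sqr_ge0.
have nE t q : n (t, q) = ((V t q).1 ^+ 2 + (V t q).2 ^+ 2) / q.2 ^+ 2 by [].
have nle t q : half_plane q -> n (t, q) <= M.
  move=> qH; have [h Gh hD] := @region_cover _ _ D _ qH.
  pose k := Num.floor (t / T); pose s := t - T *~ k.
  have sT : 0 <= s <= T.
    have /andP[f1 f2] := floor_itv (t / T).
    move: f1 f2; rewrite ler_pdivlMr// ltr_pdivrMr// intrD mulrDl mul1r.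
    move=> f1 f2; rewrite /s -mulrzr [T * _]mulrC.
    by apply/andP; split; lra.
  have -> : n (t, q) = n (s, mobius h q).
    rewrite !nE Vcomp// (_ : V s q = V t q); last first.
      by rewrite /s -mulrNz (periodic_int VT).
    rewrite (diff_mobius_norm _ (fuchsian_det Gh) qH).
    have q2 : q.2 != 0 by rewrite gt_eqF.
    have hq2 : (mobius h q).2 != 0.
      rewrite gt_eqF//; apply: (@mobius_half_plane R h q) => //.
      by rewrite (fuchsian_det Gh).
    by move: hq2; move: (mobius h q).2 => y y0; field; apply/andP.
  by apply: cmax; apply/mem_set; split => //=; rewrite in_itv.
move=> t q qH; have := nle t q qH.
have q2 : 0 < q.2 by [].
rewrite /n /= ler_pdivrMr ?exprn_gt0// => h.
have sqb (x y : R) : x ^+ 2 + y ^+ 2 <= M * q.2 ^+ 2 -> `|x| <= (M + 1) * q.2.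
  move=> xy; rewrite -(@ler_pXn2r _ 2)// ?nnegrE ?mulr_ge0 ?addr_ge0//; last exact: ltW.
  rewrite real_normK ?num_real// exprMn.
  have := sqr_ge0 y; have := exprn_gt0 2 q2; move: xy.
  move: (q.2 ^+ 2) => z xy z0 y0; have := mulr_ge0 M0 (ltW z0).
  have := mulr_ge0 (mulr_ge0 M0 M0) (ltW z0); nra.
rewrite prod_normE /= ge_max; apply/andP; split; apply: sqb; first exact: h.
by rewrite addrC; exact: h.
Qed.

(** Compatibility makes the image of a solution under [mobius h] a solution; uniqueness identifies
    it. *)
Lemma flow_equivariant (Y : R -> R -> R * R -> R * R) h t q :
  solution_map V Y -> Gamma h -> half_plane q ->
  Y t 0 (mobius h q) = mobius h (Y t 0 q).
Proof.
move=> VY Gh qH; have dh := fuchsian_det Gh.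
have hH p : half_plane p -> half_plane (mobius h p).
  by apply: mobius_half_plane; rewrite dh.
have [_ _ uniq] := VY 0 _ (hH _ qH).
have [sY Y0 _] := VY 0 _ qH.
rewrite -(uniq (fun s => mobius h (Y s 0 q)))//; last by rewrite Y0.
move=> s; have [yH yd] := sY s; split; first exact: hH.
have [md _] := is_diff_mobius dh yH.
have yd' : differentiable (fun s => Y s 0 q) s.
  by apply/derivable1_diffP; case: yd.
have cd : differentiable (mobius h \o (fun s => Y s 0 q)) s.
  exact: differentiable_comp.
apply: DeriveDef; first exact/derivable1_diffP.
have e : 'd (fun s => Y s 0 q) s 1 = V s (Y s 0 q).
  by rewrite -deriveE//; case: yd.
by rewrite deriveE// diff_comp//= e Vcomp.
Qed.

End InvariantField.

(** * The saddle *)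

Section Saddle.
Variable R : realType.

Lemma IVT0 (f : R -> R) a b : continuous f -> a <= b -> f a * f b <= 0 ->
  exists2 c, a <= c <= b & f c = 0.
Proof.
move=> cf ab fab.
have [|c cab c0] := IVT (v := 0) ab (continuous_subspaceT cf); last by exists c.
rewrite ge_min le_max; have [fa|fa] := leP (f a) 0; have [fb|fb] := leP (f b) 0;
  rewrite ?orbT//=; nra.
Qed.

Lemma expr_unbounded (m a C : R) : 1 < m -> 0 < a -> exists n, C < m ^+ n * a.
Proof.
move=> m1 a0; have bern n : 1 + (m - 1) *+ n <= m ^+ n.
  elim: n => [|n IH]; first by rewrite mulr0n addr0 expr0.
  rewrite exprS; apply: le_trans (_ : m * (1 + (m - 1) *+ n) <= _).
    rewrite mulrSr; have : 0 <= (m - 1) *+ n by rewrite mulrn_wge0 ?subr_ge0 ?ltW.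
    move: (_ *+ n) => x x0; nra.
  by rewrite ler_pM2l//; lra.
have d0 : 0 < (m - 1) * a by rewrite mulr_gt0 ?subr_gt0.
pose n := Num.bound (C / ((m - 1) * a)).
exists n; apply: lt_le_trans (_ : (1 + (m - 1) *+ n) * a <= _); last by rewrite ler_pM2r.
have := unstable.ltr_bound (C / ((m - 1) * a)).
rewrite -/n ltr_pdivrMr// -[(m - 1) *+ n]mulr_natr.
move: n%:R => x xC; apply: lt_trans xC _; rewrite [(1 + _) * a]mulrDl mul1r.
by rewrite (_ : x * _ = (m - 1) * x * a) ?ltrDr//; ring.
Qed.

Lemma continuous_bounded (f : R -> R) a b : continuous f -> a <= b ->
  exists C, forall s, a <= s <= b -> `|f s| <= C.
Proof.
move=> cf ab; have := EVT_max ab (f := fun s => `|f s|).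
case.
  apply: continuous_subspaceT => s.
  by apply: continuous_comp; [exact: cf|exact: norm_continuous].
move=> c _ cP; exists `|f c| => s sab; apply: cP.
by rewrite in_itv.
Qed.

(** Multiplying the error bound by [|u|] gives [us * u <= (mu + eta) * u ^+ 2]: in the cone, the
    dominant coordinate changes sign. *)
Lemma saddle_sign (u v us vs eta mu : R) : 0 < eta -> mu < - eta ->
  `|v| <= `|u| -> u != 0 -> `|us - mu * u| <= eta * Num.max `|u| `|v| ->
  us * u < 0.
Proof.
move=> eta0 mue vu u0; rewrite (max_idPl vu) => h.
have : `|us - mu * u| * `|u| <= eta * u ^+ 2.
  rewrite -real_normK ?num_real// expr2 mulrA ler_wpM2r//.
rewrite -normrM ler_norml => /andP[_].
by have : 0 < u ^+ 2 by [rewrite exprn_even_gt0]; nra.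
Qed.

(* u and v are the expanding and the contracting coordinate of a point moving *)
(* along the curve. The unstable cone |v| <= |u| is forward invariant, so     *)
(* forward orbits that enter it and backward orbits that leave it cannot      *)
(* remain in a bounded set.                                                   *)
Lemma saddle_no_increasing (u v sigma : R -> R) (mu nu eta e : R) :
  0 < e -> 0 < eta -> mu + eta < -1 -> -1 + eta < nu -> nu < - eta ->
  continuous u -> continuous v -> continuous sigma ->
  sigma 0 = 0 ->
  (forall s t, 0 <= s -> s < t -> t <= e -> sigma s < sigma t) ->
  (forall s, 0 < s <= e -> sigma s <> s) ->
  (forall s, 0 < s <= e -> u s != 0 \/ v s != 0) ->
  (forall s, 0 < s <= e ->
     `|u (sigma s) - mu * u s| <= eta * Num.max `|u s| `|v s| /\
     `|v (sigma s) - nu * v s| <= eta * Num.max `|u s| `|v s|) ->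
  False.
Proof.
move=> e0 eta0 mue nue nueta cu cv cs s0 smono sfix nz H.
have spos s : 0 < s <= e -> 0 < sigma s.
  by move=> /andP[h1 h2]; rewrite -s0; exact: smono.
have smonoW s t : 0 <= s -> s <= t -> t <= e -> sigma s <= sigma t.
  by move=> h1; rewrite le_eqVlt => /orP[/eqP->//|st] te; rewrite ltW// smono.
pose K s := `|v s| <= `|u s|.
have Kstep s : 0 < s <= e -> K s ->
    (- mu - eta) * `|u s| <= `|u (sigma s)| /\ K (sigma s).
  move=> se Ks; have [] := H s se; rewrite (max_idPl Ks) => h1 h2.
  have a1 : (- mu - eta) * `|u s| <= `|u (sigma s)|.
    have := lerB_dist (mu * u s) (u (sigma s)); rewrite distrC normrM [`|mu|]ler0_norm; last lra.
    move=> h3; nra.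
  split => //; apply: le_trans a1.
  have := ler_normD (v (sigma s) - nu * v s) (nu * v s); rewrite subrK normrM.
  rewrite [`|nu|]ler0_norm; last lra.
  have us0 := normr_ge0 (u s); move: Ks; rewrite /K => Ks.
  move=> h3; nra.
have nKstep s : 0 < s <= e -> ~ K s -> `|v (sigma s)| <= (- nu + eta) * `|v s|.
  move=> se /negP; rewrite -ltNge => uv.
  have [_] := H s se; rewrite (max_idPr (ltW uv)) => h2.
  have := ler_normD (v (sigma s) - nu * v s) (nu * v s); rewrite subrK normrM.
  rewrite [`|nu|]ler0_norm; last lra.
  have us0 := normr_ge0 (v s); move=> h3; nra.
have Ku s : 0 < s <= e -> K s -> u s != 0.
  move=> se Ks; have [//|vs] := nz s se.
  by move: Ks; rewrite /K => vu; rewrite -normr_gt0; apply: lt_le_trans vu; rewrite normr_gt0.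
have [Cu CuP] := continuous_bounded cu (ltW e0).
have [Cv CvP] := continuous_bounded cv (ltW e0).
have ee : 0 < e <= e by rewrite e0 lexx.
have csub : continuous (fun s => sigma s - s).
  by move=> s; apply: continuousB; [exact: cs|exact: cvg_id].
(* Since [sigma] has no fixed point in ]0, e], its position at [e] decides whether the whole arc
   moves towards 0 or away from it. *)
have [se|se] := leP (sigma e) e.
  have small s : 0 < s <= e -> sigma s < s.
    move=> /andP[h1 h2]; rewrite ltNge le_eqVlt; apply/negP => /orP[/eqP h|h].
      by apply: (sfix s); rewrite ?h1.
    have [|c /andP[c1 c2] cE] := IVT0 csub h2; first by nra.
    by apply: (sfix c); [rewrite (lt_le_trans h1)|apply/eqP; rewrite -subr_eq0 cE].
  have itr s n : 0 < s <= e -> 0 < iter n sigma s <= e.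
    move=> h; elim: n => //= n IH; rewrite spos//=.
    by apply: le_trans (ltW (small _ IH)) _; case/andP: IH.
  (* In the cone, [|u|] would grow geometrically along the forward orbit, which stays in the arc. *)
  have nK s : 0 < s <= e -> ~ K s.
    move=> h Ks.
    have gr n : (- mu - eta) ^+ n * `|u s| <= `|u (iter n sigma s)| /\ K (iter n sigma s).
      elim: n => [|n [IH1 IH2]]; first by rewrite expr0 mul1r.
      have [k1 k2] := Kstep _ (itr s n h) IH2; split=> //=.
      rewrite exprS -mulrA; apply: le_trans k1; rewrite ler_pM2l//; lra.
    have [||n nP] := @expr_unbounded (- mu - eta) `|u s| Cu; first lra.
      by rewrite normr_gt0 Ku.
    have [k1 _] := gr n; have /andP[i1 i2] := itr s n h.
    by have := CuP _ (introT andP (conj (ltW i1) i2)); lra.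
  have v0 s : 0 < s <= e -> v s != 0.
    by move=> h; have /negP := nK s h; rewrite /K -ltNge -normr_gt0; apply: le_lt_trans.
  (* Off the cone [v] does not vanish, yet it changes sign between [sigma e] and [e]. *)
  have sg : v (sigma e) * v e < 0.
    have [_ h2] := H e ee; have /negP := nK e ee; rewrite /K -ltNge => /ltW uv.
    by move: h2; rewrite maxC => h2; exact: saddle_sign eta0 nueta uv (v0 _ ee) h2.
  have [|c /andP[c1 c2] cE] := IVT0 cv se; first exact: ltW.
  by have := v0 c; rewrite cE eqxx => /(_ _)/negP; apply=> //; rewrite c2 (lt_le_trans (spos _ ee)).
have big s : 0 < s <= e -> s < sigma s.
  move=> /andP[h1 h2]; rewrite ltNge le_eqVlt; apply/negP => /orP[/eqP h|h].
    by apply: (sfix s); rewrite ?h1.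
  have [|c /andP[c1 c2] cE] := IVT0 csub h2; first by nra.
  by apply: (sfix c); [rewrite (lt_le_trans h1)|apply/eqP; rewrite -subr_eq0 cE].
have prev r : 0 < r <= e -> exists2 r', 0 < r' <= r & sigma r' = r.
  move=> /andP[h1 h2].
  have csr : continuous (fun s => sigma s - r).
    by move=> s; apply: continuousB; [exact: cs|exact: cvg_cst].
  have rr := big r; rewrite h1 h2 in rr; have {}rr := rr isT.
  have [|c /andP[c1 c2] cE] := IVT0 csr (ltW h1); first by rewrite s0; nra.
  have cr : sigma c = r by apply/eqP; rewrite -subr_eq0 cE.
  exists c => //; rewrite c2 andbT lt_neqAle c1 andbT; apply/eqP => c00.
  by move: cr; rewrite -c00 s0 => r0; rewrite -r0 ltxx in h1.
(* Orbits are now followed backwards: off the cone [|v|] contracts forwards, so it would grow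
   geometrically along the backward orbit. *)
have allK s : 0 < s <= e -> K s.
  move=> h; apply: contrapT => nK.
  have back n : exists r, [/\ 0 < r <= e, ~ K r & `|v s| <= (- nu + eta) ^+ n * `|v r|].
    elim: n => [|n [r [r1 r2 r3]]]; first by exists s; rewrite expr0 mul1r.
    have [r' /andP[p1 p2] rE] := prev r r1.
    have r'e : 0 < r' <= e by rewrite p1 (le_trans p2)//; case/andP: r1.
    have nK' : ~ K r' by move=> Kr'; have [_] := Kstep r' r'e Kr'; rewrite rE.
    exists r'; split => //; apply: le_trans r3 _.
    rewrite exprSr -mulrA ler_wpM2l//; first by apply: exprn_ge0; lra.
    by rewrite -{1}rE nKstep.
  have vs0 : 0 < `|v s| by apply: le_lt_trans (normr_ge0 (u s)) _; rewrite ltNge; apply/negP.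
  have rho0 : 0 < - nu + eta by lra.
  have [||n nP] := @expr_unbounded (- nu + eta)^-1 `|v s| Cv => //.
    by rewrite invf_gt1//; lra.
  have [r [/andP[r1 r2] _ r3]] := back n.
  have vr := CvP r (introT andP (conj (ltW r1) r2)).
  move: nP; rewrite exprVn mulrC ltr_pdivlMr ?exprn_gt0// ltNge => /negP; apply.
  by apply: le_trans r3 _; rewrite mulrC ler_pM2r// exprn_gt0.
have [r' /andP[p1 p2] rE] := prev e ee.
have r'e : 0 < r' <= e by rewrite p1.
(* The same contradiction for [u], between [r'] and [e = sigma r']. *)
have sg : u (sigma r') * u r' < 0.
  have [h1 _] := H r' r'e.
  have mue2 : mu < - eta by lra.
  exact: saddle_sign eta0 mue2 (allK _ r'e) (Ku _ r'e (allK _ r'e)) h1.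
have [|c /andP[c1 c2] cE] := IVT0 cu p2; first by rewrite -rE mulrC ltW.
have ce : 0 < c <= e by rewrite c2 (lt_le_trans p1).
by have := Ku c ce (allK _ ce); rewrite cE eqxx.
Qed.

Lemma left_eigenvector (al be ga de la : R) :
  (al - la) * (de - la) - be * ga = 0 ->
  exists p q, [/\ p != 0 \/ q != 0, p * al + q * ga = la * p
    & p * be + q * de = la * q].
Proof.
move=> ch; have [ga0|ga0] := eqVneq ga 0; last first.
  by exists ga, (la - al); split; [left|ring|lra].
have [lade|lade] := eqVneq (la - de) 0.
  by exists 0, 1; split; [right; rewrite oner_eq0|rewrite ga0; ring|lra].
exists (la - de), be; split; [by left| |ring].
by rewrite ga0 in ch *; lra.
Qed.

(** The left eigenvectors give coordinates that diagonalise the differential of [M];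
    differentiability makes the remainder small relative to the larger coordinate, which is the
    setting of [saddle_no_increasing]. *)
Lemma saddle_curve (M : R * R -> R * R) A (c : R -> R * R) (sigma : R -> R) :
  inversely_unstable_at M A -> continuous c -> c 0 = A ->
  (forall s, 0 < s < 1 -> c s <> A) -> (forall s, M (c s) = c (sigma s)) ->
  continuous sigma -> sigma 0 = 0 -> {homo sigma : s t / s < t} -> False.
Proof.
move=> [al [be [ga [de [l1 [l2 [[MA iso] dM dE ch [l2m1 /andP[l1m1 l10]]]]]]]]].
move=> cc c0 cinj Mc cs s0 smono.
have eig (l : R) : (l - l1) * (l - l2) = 0 -> exists p q, [/\ p != 0 \/ q != 0,
    p * al + q * ga = l * p & p * be + q * de = l * q].
  by move=> h; apply: left_eigenvector; rewrite ch.
have [p1 [q1 [n1 e1 f1]]] : exists p q, [/\ p != 0 \/ q != 0,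
    p * al + q * ga = l1 * p & p * be + q * de = l1 * q].
  by apply: eig; rewrite subrr mul0r.
have [p2 [q2 [n2 e2 f2]]] : exists p q, [/\ p != 0 \/ q != 0,
    p * al + q * ga = l2 * p & p * be + q * de = l2 * q].
  by apply: eig; rewrite subrr mulr0.
have dl : l1 - l2 != 0 by rewrite subr_eq0 gt_eqF//; lra.
(* The determinant of the two coordinates, nonzero because the eigenvalues differ. *)
pose Dt := p1 * q2 - p2 * q1.
have Dt0 : Dt != 0.
  apply/eqP => Dt0.
  have pp : (l1 - l2) * (p1 * p2) = 0.
    transitivity (p2 * (l1 * p1) - p1 * (l2 * p2)); first by ring.
    rewrite -e1 -e2; transitivity (- ga * Dt); first by rewrite /Dt; ring.
    by rewrite Dt0 mulr0.
  have qq : (l1 - l2) * (q1 * q2) = 0.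
    transitivity (q2 * (l1 * q1) - q1 * (l2 * q2)); first by ring.
    rewrite -f1 -f2; transitivity (be * Dt); first by rewrite /Dt; ring.
    by rewrite Dt0 mulr0.
  move/eqP: pp; rewrite mulf_eq0 (negbTE dl)/= mulf_eq0.
  move/eqP: qq; rewrite mulf_eq0 (negbTE dl)/= mulf_eq0.
  move: n1 n2 Dt0; rewrite /Dt => n1 n2 Dt0 h1 h2.
  have [p10|p10] := eqVneq p1 0.
    move: n1 h1 Dt0; rewrite p10 eqxx mul0r sub0r => -[//|q10].
    rewrite (negbTE q10)/= => /eqP q20; rewrite q20 eqxx in n2.
    case: n2 => // p20 /eqP; rewrite oppr_eq0 mulf_eq0 (negbTE q10) orbF.
    by rewrite (negbTE p20).
  move: h2 n2 h1 Dt0; rewrite (negbTE p10)/= => /eqP ->; rewrite eqxx mul0r subr0 => -[//|q20].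
  rewrite (negbTE q20) orbF => /eqP _ /eqP.
  by rewrite mulf_eq0 (negbTE p10) (negbTE q20).
pose u s := p2 * (c s - A).1 + q2 * (c s - A).2.
pose v s := p1 * (c s - A).1 + q1 * (c s - A).2.
have c1 : continuous (fun s => (c s - A).1).
  move=> s; apply: (@continuous_comp _ _ _ (fun s => c s - A) fst); last exact: cvg_fst.
  by apply: continuousB; [exact: cc|exact: cvg_cst].
have c2 : continuous (fun s => (c s - A).2).
  move=> s; apply: (@continuous_comp _ _ _ (fun s => c s - A) snd); last exact: cvg_snd.
  by apply: continuousB; [exact: cc|exact: cvg_cst].
have clin p q : continuous (fun s => p * (c s - A).1 + q * (c s - A).2).
  move=> s.
  have h1 : {for s, continuous (fun s => p * (c s - A).1)}.
    by apply: (@continuousM _ _ (fun=> p)); [exact: cvg_cst|exact: c1].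
  have h2 : {for s, continuous (fun s => q * (c s - A).2)}.
    by apply: (@continuousM _ _ (fun=> q)); [exact: cvg_cst|exact: c2].
  exact: continuousD h1 h2.
pose Q := `|p1| + `|q1| + `|p2| + `|q2|.
have Q0 : 0 <= Q by rewrite !addr_ge0.
(* By Cramer's rule, [kap] compares the norm of [c s - A] with its eigencoordinates. *)
pose kap := (Q + Q) / `|Dt|.
have kap0 : 0 <= kap by rewrite divr_ge0 ?addr_ge0.
have small s : `|c s - A| <= kap * Num.max `|u s| `|v s|.
  pose m := Num.max `|u s| `|v s|.
  have um : `|u s| <= m by rewrite le_max lexx.
  have vm : `|v s| <= m by rewrite le_max lexx orbT.
  have m0 : 0 <= m by apply: le_trans um.
  have Dn : 0 < `|Dt| by rewrite normr_gt0.
  have bnd (a b x y w : R) : `|a| <= Q -> `|b| <= Q -> `|x| <= m -> `|y| <= m ->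
      Dt * w = a * x - b * y -> `|w| <= kap * m.
    move=> aQ bQ xm ym e; rewrite /kap mulrAC ler_pdivlMr// mulrC -normrM e.
    apply: le_trans (ler_normB _ _) _; rewrite !normrM mulrDl.
    by apply: lerD; apply: ler_pM.
  have Qp : [/\ `|p1| <= Q, `|q1| <= Q, `|p2| <= Q & `|q2| <= Q].
    rewrite /Q; move: (normr_ge0 p1) (normr_ge0 q1) (normr_ge0 p2) (normr_ge0 q2).
    move: `|p1| `|q1| `|p2| `|q2| => a b x y a0 b0 x0 y0.
    by split; rewrite -subr_ge0; [rewrite (_ : _ - _ = b + x + y)|rewrite (_ : _ - _ = a + x + y)|
      rewrite (_ : _ - _ = a + b + y)|rewrite (_ : _ - _ = a + b + x)]; rewrite ?addr_ge0//; ring.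
  have [P1 P2 P3 P4] := Qp.
  rewrite prod_normE /= ge_max; apply/andP; split.
    by apply: (bnd q2 q1 (v s) (u s)) => //; rewrite /u /v /Dt; ring.
  by apply: (bnd p1 p2 (u s) (v s)) => //; rewrite /u /v /Dt; ring.
(* Half of the distance of [l2] from -1 and of [l1] from -1 and from 0, whichever is least. *)
pose eta := Num.min ((- 1 - l2) / 2) (Num.min ((1 + l1) / 2) (- l1 / 2)).
have eta0 : 0 < eta by rewrite !lt_min; apply/and3P; split; lra.
have [et1 et2 et3] : [/\ eta <= (- 1 - l2) / 2, eta <= (1 + l1) / 2 & eta <= - l1 / 2].
  by rewrite /eta !ge_min !lexx !orbT.
pose eta' := eta / ((Q + 1) * (kap + 1)).
have QK0 : 0 < (Q + 1) * (kap + 1) by rewrite mulr_gt0// ltr_wpDl.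
have eta'0 : 0 < eta' by rewrite divr_gt0.
have nearM : \forall q \near A, `|M q - A - 'd M A (q - A)| <= eta' * `|q - A|.
  have /diff_locallyP[_ /eqaddoP] := dM.
  move=> /(_ _ eta'0) /nbhs_ballP[r /= r0 rP].
  apply/nbhs_ballP; exists r => // q Aq.
  have := rP (q - A); rewrite !fctE /= subrK MA opprD addrA; apply.
  by move: Aq; rewrite -!ball_normE /= sub0r opprB.
have near0 : \forall s \near (0 : R), `|M (c s) - A - 'd M A (c s - A)| <= eta' * `|c s - A|
    /\ (M (c s) = c s -> c s = A).
  have cA : c x @[x --> (0 : R)] --> A by rewrite -c0; exact: cc.
  have {}cA P : (\forall q \near A, P q) -> \forall s \near (0 : R), P (c s).
    exact: cA.
  have n1' := cA _ nearM; have n2' := cA _ iso.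
  by near=> s; split; near: s.
have /nbhs_ballP[r /= r0 rP] := near0.
(* Below [r] the linearisation is valid; below 1 the curve has not returned to [A]. *)
pose e := Num.min (r / 2) (1 / 2).
have e0 : 0 < e by rewrite lt_min !divr_gt0.
have [er e1'] : e <= r / 2 /\ e <= 1 / 2 by rewrite /e !ge_min !lexx orbT.
have inr s : 0 < s <= e -> ball (0 : R) r s.
  move=> /andP[h1 h2]; rewrite /ball /= sub0r normrN gtr0_norm//; lra.
have s1 s : 0 < s <= e -> c s <> A.
  by move=> /andP[h1 h2]; apply: cinj; apply/andP; split=> //; lra.
have funE (p q l : R) s : p * al + q * ga = l * p -> p * be + q * de = l * q ->
    `|p| + `|q| <= Q -> 0 < s <= e ->
    `|p * (c (sigma s) - A).1 + q * (c (sigma s) - A).2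
      - l * (p * (c s - A).1 + q * (c s - A).2)| <= eta * Num.max `|u s| `|v s|.
  move=> pe qe pqQ se; have [h _] := rP s (inr s se).
  pose w := M (c s) - A - 'd M A (c s - A).
  have wE : w = ((c (sigma s) - A).1 - (al * (c s - A).1 + be * (c s - A).2),
                 (c (sigma s) - A).2 - (ga * (c s - A).1 + de * (c s - A).2)).
    by rewrite /w Mc [X in 'd M A X]surjective_pairing dE.
  have -> : p * (c (sigma s) - A).1 + q * (c (sigma s) - A).2
      - l * (p * (c s - A).1 + q * (c s - A).2) = p * w.1 + q * w.2.
    rewrite wE -[(_, _).1]/(_ - _) -[(_, _).2]/(_ - _).
    set x := (c (sigma s) - A).1; set y := (c (sigma s) - A).2.
    set x' := (c s - A).1; set y' := (c s - A).2.
    transitivity (p * x + q * y - ((l * p) * x' + (l * q) * y')); first by ring.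
    by rewrite -pe -qe; ring.
  have wn : `|w| <= eta' * (kap * Num.max `|u s| `|v s|).
    by apply: le_trans h _; rewrite ler_pM2l.
  have w1 : `|w.1| <= `|w| by rewrite [leRHS]prod_normE le_max lexx.
  have w2 : `|w.2| <= `|w| by rewrite [leRHS]prod_normE le_max lexx orbT.
  apply: le_trans (ler_normD _ _) _; rewrite !normrM.
  have m0 : 0 <= Num.max `|u s| `|v s| by rewrite le_max normr_ge0.
  apply: le_trans (_ : Q * `|w| <= _).
    apply: le_trans (_ : (`|p| + `|q|) * `|w| <= _); last by rewrite ler_wpM2r.
    by rewrite mulrDl lerD// ler_wpM2l.
  apply: le_trans (ler_wpM2l Q0 wn) _.
  rewrite !mulrA ler_wpM2r// /eta' -!mulrA mulrCA ler_piMr//; first exact: ltW.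
  rewrite [_^-1 * kap]mulrC mulrA ler_pdivrMr// mul1r.
  by rewrite ler_pM// ?lerDl.
apply: (@saddle_no_increasing u v sigma l2 l1 eta e) => //.
- lra.
- lra.
- lra.
- exact: clin.
- exact: clin.
- by move=> s t _ st _; exact: smono.
- move=> s se sE; apply: (s1 s se); have [_] := rP s (inr s se); apply.
  by rewrite Mc sE.
- move=> s se; apply/orP; rewrite -negb_and; apply/negP => /andP[/eqP us /eqP vs].
  have := small s; rewrite us vs normr0 maxxx mulr0 normr_le0 subr_eq0 => /eqP.
  exact: s1.
- move=> s se; split; apply: funE => //; rewrite /Q.
    by have := normr_ge0 p1; have := normr_ge0 q1; lra.
  by have := normr_ge0 p2; have := normr_ge0 q2; lra.
Unshelve. all: by end_near. Qed.

End Saddle.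

(** * Odd loops *)

Section Angles.
Variable R : realType.
Implicit Types (a b : R * R) (s t th : R).

Definition angle a th := exists2 r : R, 0 < r & a = (r * cos th, r * sin th).

Definition dot a b : R := a.1 * b.1 + a.2 * b.2.
Definition cross a b : R := a.1 * b.2 - a.2 * b.1.

(** The increment of the argument between vectors at an acute angle is an explicit continuous
    function of both; [angle_lift] adds up such increments. *)
Lemma angle_step a b th : angle a th -> 0 < dot a b ->
  angle b (th + atan (cross a b / dot a b)).
Proof.
move=> [r r0 ->]; case: b => x y; rewrite /dot /cross /= => d0.
set d := _ + _ in d0 *; set k := _ - _; set f := atan _.
have [f1 f2] := atan_def (k / d); rewrite -/f in f1 f2.
have cf : 0 < cos f by exact: cos_gt0_pihalf.
have sf : sin f = k / d * cos f by rewrite -f2 /tan divfK// gt_eqF.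
have cs := cos2Dsin2 th.
have d0' : d != 0 by rewrite gt_eqF.
have cf' : cos f != 0 by rewrite gt_eqF.
have r0' : r != 0 by rewrite gt_eqF.
exists (d / (r * cos f)); first by rewrite divr_gt0// mulr_gt0.
rewrite cosD sinD sf; congr (_, _).
  transitivity ((d * cos th - k * sin th) / r); last by field; apply/and3P.
  apply: (mulIf r0'); rewrite divfK// /d /k -[LHS]mul1r -cs; ring.
transitivity ((d * sin th + k * cos th) / r); last by field; apply/and3P.
apply: (mulIf r0'); rewrite divfK// /d /k -[LHS]mul1r -cs; ring.
Qed.

Lemma angle_exists a : a != 0 -> exists th, angle a th.
Proof.
have unit th : angle (cos th, sin th) th by exists 1; rewrite ?mul1r.
have e0 := unit 0; have e1 := unit (pi / 2); have e2 := unit pi.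
have e3 := unit (- (pi / 2)).
rewrite cos0 sin0 in e0; rewrite cos_pihalf sin_pihalf in e1.
rewrite cospi sinpi in e2; rewrite cosN sinN cos_pihalf sin_pihalf in e3.
case: a => x y nz.
have [x0|x0|x0] := ltgtP x 0.
- by eexists; apply: angle_step e2 _; rewrite /dot /=; lra.
- by eexists; apply: angle_step e0 _; rewrite /dot /=; lra.
have [y0|y0|y0] := ltgtP y 0.
- by eexists; apply: angle_step e3 _; rewrite /dot /=; lra.
- by eexists; apply: angle_step e1 _; rewrite /dot /=; lra.
by move: nz; rewrite x0 y0 eqxx.
Qed.

Lemma cos_eq1 (x : R) : cos x = 1 -> exists n : int, x = (pi *+ 2) *~ n.
Proof.
have p0 := @pi_gt0 R.
have cper (n : nat) (y : R) : cos (y + (pi *+ 2) *+ n) = cos y.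
  exact: (periodicn (@cosD2pi R)) n y.
have cperz (n : int) (y : R) : cos (y + (pi *+ 2) *~ n) = cos y.
  case: n => n; first by rewrite -pmulrn cper.
  by rewrite NegzE mulrNz -pmulrn -[LHS](cper n.+1) subrK.
move=> cx; pose n := Num.floor (x / (pi *+ 2)); exists n.
pose y := x - (pi *+ 2) *~ n.
have cy : cos y = 1 by rewrite /y -mulrNz cperz.
have tp : 0 < pi *+ 2 :> R by rewrite pmulrn_lgt0.
have yb : 0 <= y < pi *+ 2.
  have /andP[f1 f2] := floor_itv (x / (pi *+ 2)).
  move: f1 f2; rewrite ler_pdivlMr// ltr_pdivrMr// intrD mulrDl mul1r.
  move=> f1 f2; rewrite /y -mulrzr [_ * n%:~R]mulrC.
  by apply/andP; split; lra.
suff y0 : y = 0 by apply/eqP; rewrite -subr_eq0; apply/eqP.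
move: yb => /andP[y1 y2].
have i0 : (0 : R) \in `[0, pi]%R by rewrite in_itv /= lexx ltW.
have [yp|yp] := leP y pi.
  by apply: cos_inj => //; rewrite ?in_itv /= ?y1 // cy cos0.
have : pi *+ 2 - y = 0.
  apply: cos_inj => //.
    by rewrite in_itv /=; apply/andP; split; rewrite mulr2n; rewrite mulr2n in y2; lra.
  by rewrite addrC cosD2pi cosN cy cos0.
by move: y2; rewrite mulr2n; lra.
Qed.

Lemma angle_unique a th th' : angle a th -> angle a th' ->
  exists n : int, th' - th = (pi *+ 2) *~ n.
Proof.
move=> [r r0 ->] [r' r'0 [e1 e2]].
have c1 := cos2Dsin2 th; have c2 := cos2Dsin2 th'.
have rr : r = r'.
  have : r ^+ 2 = r' ^+ 2.
    rewrite -[LHS]mulr1 -[RHS]mulr1 -[in LHS]c1 -c2 !mulrDr -!exprMn.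
    by rewrite e1 e2.
  by move/eqP; rewrite eqrXn2 ?ltW// => /eqP.
apply: cos_eq1; rewrite cosB; rewrite rr in e1 e2.
have r'n : r' != 0 by rewrite gt_eqF.
by rewrite -(mulfI r'n e1) -(mulfI r'n e2) -!expr2.
Qed.

Lemma angleN a th : angle a th -> angle (- a) (th + pi).
Proof.
by move=> [r r0 ->]; exists r => //; rewrite cosDpi sinDpi !mulrN.
Qed.

Lemma dot_continuous (T : topologicalType) (f g : T -> R * R) x :
  {for x, continuous f} -> {for x, continuous g} ->
  {for x, continuous (fun y => dot (f y) (g y))}.
Proof.
move=> cf cg.
have f1 := continuous_fst cf; have f2 := continuous_snd cf.
have g1 := continuous_fst cg; have g2 := continuous_snd cg.
exact: continuousD (continuousM f1 g1) (continuousM f2 g2).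
Qed.

Lemma cross_continuous (T : topologicalType) (f g : T -> R * R) x :
  {for x, continuous f} -> {for x, continuous g} ->
  {for x, continuous (fun y => cross (f y) (g y))}.
Proof.
move=> cf cg.
have f1 := continuous_fst cf; have f2 := continuous_snd cf.
have g1 := continuous_fst cg; have g2 := continuous_snd cg.
exact: continuousB (continuousM f1 g2) (continuousM f2 g1).
Qed.

(** The square is contracted radially to its corner 0, in [N] steps so short that successive values
    of [F] make an acute angle; the angle at 0 is then continued by [angle_step]. *)
Lemma angle_lift (F : R * R -> R * R) : continuous F -> (forall q, F q != 0) ->
  exists Th : R * R -> R, forall q, `[0, 1]%classic q.1 -> `[0, 1]%classic q.2 ->
    {for q, continuous Th} /\ angle (F q) (Th q).
Proof.
move=> cF nF.
pose K := (`[0, 1] `*` `[0, 1])%classic : set (R * R).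
have cK : compact K by apply: compact_setX; exact: segment_compact.
have [d d0 dP] : exists2 d : R, 0 < d & forall p, K p -> forall p', `|p - p'| < d ->
    0 < dot (F p) (F p').
  have := cK; move/compact_near_coveringP.
  move=> /(_ R (0 : R)^'+ (fun e p => forall p', `|p - p'| < e -> 0 < dot (F p) (F p')) _).
  case.
    move=> x _.
    have cd : {for (x, x), continuous (fun u : (R * R) * (R * R) => dot (F u.1) (F u.2))}.
      apply: dot_continuous.
        by apply: (@continuous_comp _ _ _ fst F); [exact: cvg_fst|exact: cF].
      by apply: (@continuous_comp _ _ _ snd F); [exact: cvg_snd|exact: cF].
    have dx : 0 < dot (F x) (F x).
      have := nF x; rewrite /dot; case: (F x) => a b /= nz.
      rewrite -!expr2 lt_neqAle addr_ge0 ?sqr_ge0// andbT eq_sym.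
      rewrite paddr_eq0 ?sqr_ge0// !sqrf_eq0.
      by apply/negP => /andP[/eqP a0 /eqP b0]; rewrite a0 b0 eqxx in nz.
    have : \forall u \near (x, x), 0 < dot (F u.1) (F u.2).
      by apply: (cvgr_gt _ cd).
    move=> /nbhs_ballP[r /= r0 rP].
    exists (ball x (r / 2), [set e | e <= r / 2]) => /=.
      by split; [apply: nbhsx_ballx; rewrite divr_gt0|apply: nbhs_right_le; rewrite divr_gt0].
    move=> [p e] /= [bx er] p' pp'; apply: (rP (p, p')); split => /=.
      by apply: le_ball bx; rewrite ler_pdivrMr// ler_pMr// ler1n.
    rewrite (splitr r); apply: ball_triangle bx _.
    by rewrite -ball_normE /=; apply: lt_le_trans er.
  move=> e /= e0 eP; exists (e / 2); first by rewrite divr_gt0.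
  move=> p Kp p' pp'; apply: (eP (e / 2)) => //.
  - by rewrite /ball /= sub0r normrN gtr0_norm ?divr_gt0//; move: e0 => /=; lra.
  - by rewrite /= divr_gt0.
pose N := (Num.bound (d^-1)).+1.
have Nd : N%:R^-1 < d.
  rewrite -[d]invrK ltf_pV2 ?posrE ?invr_gt0 ?ltr0n//.
  by apply: lt_trans (unstable.ltr_bound _) _; rewrite ltr_nat.
have [th0 th0P] := angle_exists (nF 0).
pose G (k : nat) (q : R * R) := F ((k%:R / N%:R) *: q).
have cG k : continuous (G k).
  by move=> q; apply: continuous_comp; [exact: scaler_continuous|exact: cF].
have N0 : (0 : R) < N%:R by rewrite ltr0n.
have ind k : (k <= N)%N -> exists Th : R * R -> R, forall q, K q ->
    {for q, continuous Th} /\ angle (G k q) (Th q).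
  elim: k => [|k IH] kN.
    exists (fun=> th0) => q _; split; first exact: cst_continuous.
    by rewrite /G mul0r scale0r.
  have [Th ThP] := IH (ltnW kN).
  exists (fun q => Th q + atan (cross (G k q) (G k.+1 q) / dot (G k q) (G k.+1 q))).
  move=> q Kq; have [cT aT] := ThP q Kq.
  have kN1 : k%:R / N%:R <= 1 :> R by rewrite ler_pdivrMr// mul1r ler_nat ltnW.
  have k0 : 0 <= k%:R / N%:R :> R by rewrite divr_ge0// ler0n.
  have dq : 0 < dot (G k q) (G k.+1 q).
    move: Kq => [] /=; rewrite !in_itv /= => /andP[q1 q2] /andP[q3 q4].
    apply: dP; first by split; rewrite /= in_itv /= mulr_ge0//= mulr_ile1.
    rewrite -scalerBl -mulrBl -natr1 opprD addrA subrr sub0r mulN1r scaleNr normrN.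
    rewrite normrZ gtr0_norm ?invr_gt0//; apply: le_lt_trans Nd.
    apply: ler_piMr; first by rewrite invr_ge0 ltW.
    by rewrite prod_normE /= ge_max !ger0_norm// q2.
  split; last exact: angle_step.
  have cc := cross_continuous (@cG k q) (@cG k.+1 q).
  have cd := dot_continuous (@cG k q) (@cG k.+1 q).
  have cat : {for q, continuous (fun q =>
      atan (cross (G k q) (G k.+1 q) / dot (G k q) (G k.+1 q)))}.
    apply: (@continuous_comp _ _ _
      (fun q => cross (G k q) (G k.+1 q) / dot (G k q) (G k.+1 q)) (@atan R));
      last exact: continuous_atan.
    have ci : {for q, continuous (fun q => (dot (G k q) (G k.+1 q))^-1)}.
      by apply: continuousV => //; exact: lt0r_neq0.
    exact: (@continuousM _ _ (fun q => cross (G k q) (G k.+1 q)) _ q cc ci).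
  exact: continuousD cT cat.
have [Th ThP] := ind N (leqnn _).
exists Th => q q1 q2; have [cT] := ThP q (conj q1 q2).
by rewrite /G divff ?scale1r// gt_eqF.
Qed.

(** Between distinct integers [h] would take a half-integral value. *)
Lemma int_valued_constant (h : R -> R) (a b : R) : a <= b ->
  (forall t, a <= t <= b -> {for t, continuous h}) ->
  (forall t, a <= t <= b -> h t \is a Num.int) -> h a = h b.
Proof.
move=> ab ch ih.
have cw : {within `[a, b], continuous h}.
  by apply: continuous_in_subspaceT => t /set_mem /=; rewrite in_itv; exact: ch.
have /intrP[m ma] : h a \is a Num.int by apply: ih; rewrite lexx.
have /intrP[n nb] : h b \is a Num.int by apply: ih; rewrite ab lexx.
apply/eqP; rewrite eq_le; apply/andP; split; rewrite leNgt; apply/negP => lt.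
- have [|c cab cE] := IVT (v := h b + 2^-1) ab cw.
    move: lt; rewrite ge_min le_max ma nb ltr_int -lezD1 -(ler_int R) intrD => lt.
    by apply/andP; split; apply/orP; [right|left]; lra.
  rewrite in_itv /= in cab; have /intrP[k kE] := ih c cab.
  move: cE; rewrite kE nb => cE.
  have k1 : n < k by rewrite -(ltr_int R) cE; lra.
  have k2 : k < n + 1 by rewrite -(ltr_int R) cE intrD; lra.
  by move: k1; rewrite -lezD1 => /(lt_le_trans k2); rewrite ltxx.
- have [|c cab cE] := IVT (v := h a + 2^-1) ab cw.
    move: lt; rewrite ge_min le_max ma nb ltr_int -lezD1 -(ler_int R) intrD => lt.
    by apply/andP; split; apply/orP; [left|right]; lra.
  rewrite in_itv /= in cab; have /intrP[k kE] := ih c cab.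
  move: cE; rewrite kE ma => cE.
  have k1 : m < k by rewrite -(ltr_int R) cE; lra.
  have k2 : k < m + 1 by rewrite -(ltr_int R) cE intrD; lra.
  by move: k1; rewrite -lezD1 => /(lt_le_trans k2); rewrite ltxx.
Qed.

(** The angle of [E] increases by 2 [m] + 1 half turns on [0, 1/2]: for an odd loop of period 1 this
    odd number is its degree. *)
Definition half_turns (E : R -> R * R) (m : int) := exists Th : R -> R,
  (forall s, 0 <= s <= 2^-1 -> {for s, continuous Th} /\ angle (E s) (Th s)) /\
  Th 2^-1 = Th 0 + pi + (pi *+ 2) *~ m.

Let tpi0 : (pi *+ 2 : R) != 0.
Proof. by rewrite mulrn_eq0 /= gt_eqF// pi_gt0. Qed.

Let mulz_tpi (n : int) : (pi *+ 2) *~ n / (pi *+ 2) = n%:~R :> R.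
Proof. by rewrite -mulrzr mulrC mulKf. Qed.

Let continuous_div (g : R -> R) k t : {for t, continuous g} ->
  {for t, continuous (fun s => g s / k)}.
Proof. by move=> cg; apply: (@continuousM _ _ g (fun=> k^-1)) => //; exact: cst_continuous. Qed.

(** Oddness makes the count an integer at each time [t], and the lifted angle makes it continuous in
    [t]. *)
Lemma half_turns_homotopy (F : R * R -> R * R) : continuous F ->
  (forall q, F q != 0) -> (forall t, F (2^-1, t) = - F (0, t)) ->
  exists m, half_turns (fun s => F (s, 0)) m /\ half_turns (fun s => F (s, 1)) m.
Proof.
move=> cF nF sF; have [Th ThP] := angle_lift cF nF.
have i0 : `[0, 1]%classic (0 : R) by rewrite /= in_itv /= lexx ler01.
have i1 : `[0, 1]%classic (1 : R) by rewrite /= in_itv /= lexx ler01.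
have ih : `[0, 1]%classic (2^-1 : R) by rewrite /= in_itv /=; apply/andP; split; lra.
pose h t := (Th (2^-1, t) - Th (0, t) - pi) / (pi *+ 2).
have cp1 s t : `[0, 1]%classic s -> `[0, 1]%classic t ->
    {for t, continuous (fun t => Th (s, t))}.
  move=> s1 t1; apply: (@continuous_comp _ _ _ (fun t => (s, t)) Th).
    by apply: continuous_pair; [exact: cst_continuous|exact: cvg_id].
  by have [] := ThP (s, t) s1 t1.
have cp2 s t : `[0, 1]%classic s -> `[0, 1]%classic t ->
    {for s, continuous (fun s => Th (s, t))}.
  move=> s1 t1; apply: (@continuous_comp _ _ _ (fun s => (s, t)) Th).
    by apply: continuous_pair; [exact: cvg_id|exact: cst_continuous].
  by have [] := ThP (s, t) s1 t1.
have hz t : `[0, 1]%classic t -> exists m : int, h t = m%:~R /\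
    Th (2^-1, t) = Th (0, t) + pi + (pi *+ 2) *~ m.
  move=> t1; have [_ a0] := ThP (0, t) i0 t1; have [_ a1] := ThP (2^-1, t) ih t1.
  rewrite sF in a1; have [m mE] := angle_unique (angleN a0) a1.
  exists m; rewrite -mE; split; last by ring.
  by rewrite -mulz_tpi -mE /h; congr (_ / _); ring.
have h01 : h 0 = h 1.
  apply: int_valued_constant => // t t1.
    have c1 : {for t, continuous (fun t => Th (2^-1, t) - Th (0, t) - pi)}.
      apply: (@continuousB _ _ _ (fun t => Th (2^-1, t) - Th (0, t)) (fun=> pi)).
        apply: (@continuousB _ _ _ (fun t => Th (2^-1, t)) (fun t => Th (0, t))).
          by apply: cp1 => //=; rewrite in_itv.
        by apply: cp1 => //=; rewrite in_itv.
      exact: cst_continuous.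
    exact: continuous_div c1.
  by have [|m [-> _]] := hz t; rewrite ?intr_int//= in_itv.
have [m0 [m0E T0]] := hz 0 i0; have [m1 [m1E T1]] := hz 1 i1.
have m01 : m0 = m1 by apply/eqP; rewrite -(eqr_int R) -m0E -m1E h01.
have hs s : 0 <= s <= 2^-1 -> `[0, 1]%classic s.
  by move=> /andP[h1 h2]; rewrite /= in_itv /= h1 /=; lra.
exists m0; split.
  exists (fun s => Th (s, 0)); split=> // s /hs s1; split; first exact: cp2.
  by have [] := ThP (s, 0) s1 i0.
exists (fun s => Th (s, 1)); split; last by rewrite m01.
move=> s /hs s1; split; first exact: cp2.
by have [] := ThP (s, 1) s1 i1.
Qed.

Lemma half_turns_unique E m m' : half_turns E m -> half_turns E m' -> m = m'.
Proof.
move=> [Th [ThP e]] [Th' [ThP' e']].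
have h0 : (0 : R) <= 2^-1 by rewrite invr_ge0.
pose h s := (Th' s - Th s) / (pi *+ 2).
have : h 0 = h 2^-1.
  apply: int_valued_constant => // s s1.
    have c1 : {for s, continuous (fun s => Th' s - Th s)}.
      exact: continuousB (ThP' s s1).1 (ThP s s1).1.
    exact: continuous_div c1.
  have [n nE] := angle_unique (ThP s s1).2 (ThP' s s1).2.
  by rewrite /h nE mulz_tpi intr_int.
rewrite /h e e' => he.
have : (pi *+ 2) *~ m' = (pi *+ 2) *~ m :> R.
  apply: (addrI (Th' 0 + pi)); move/(congr1 (fun x => x * (pi *+ 2))): he.
  by rewrite !divfK//; lra.
move/(congr1 (fun x => x / (pi *+ 2))); rewrite !mulz_tpi => /eqP.
by rewrite eqr_int => /eqP.
Qed.

(** Reversal negates the total angle, and -(2 m + 1) = 2 (- m - 1) + 1. *)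
Lemma half_turns_flip (E E' : R -> R * R) m :
  (forall s, 0 <= s <= 2^-1 -> E' s = - E (2^-1 - s)) ->
  half_turns E m -> half_turns E' (- m - 1).
Proof.
move=> EE [Th [ThP e]]; exists (fun s => Th (2^-1 - s) + pi); split.
  move=> s /andP[s0 s1].
  have ss : 0 <= 2^-1 - s <= 2^-1 by apply/andP; split; lra.
  have [cT aT] := ThP _ ss; split; last by rewrite EE ?s0//; exact: angleN.
  apply: (@continuousD _ _ _ (fun s => Th (2^-1 - s)) (fun=> pi)); last exact: cst_continuous.
  apply: (@continuous_comp _ _ _ (fun s => 2^-1 - s) Th) => //.
  by apply: cvgB; [exact: cvg_cst|exact: cvg_id].
rewrite subrr subr0 e mulrzBr mulrNz mulr1z.
move: (_ *~ m) => x; rewrite mulr2n; ring.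
Qed.

(* The angle of an odd loop increases by an odd multiple of pi over half a   *)
(* period, and reversing the loop changes the sign of this odd number.       *)
Lemma odd_loop_not_reversible (F1 F2 : R * R -> R * R) :
  continuous F1 -> continuous F2 -> (forall q, F1 q != 0) -> (forall q, F2 q != 0) ->
  (forall t, F1 (2^-1, t) = - F1 (0, t)) -> (forall t, F2 (2^-1, t) = - F2 (0, t)) ->
  (forall s, F1 (s, 1) = F2 (s, 0)) ->
  (forall s, 0 <= s <= 2^-1 -> F2 (s, 1) = - F1 (2^-1 - s, 0)) -> False.
Proof.
move=> c1 c2 n1 n2 s1 s2 e12 e21.
have [m [h1 h2]] := half_turns_homotopy c1 n1 s1.
have [m' [h3 h4]] := half_turns_homotopy c2 n2 s2.
have mm' : m = m'.
  apply: half_turns_unique h2 _.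
  by rewrite (_ : (fun s => F1 (s, 1)) = (fun s => F2 (s, 0)))//; apply/funext.
(* The two homotopies joined together give [m = - m - 1], impossible by parity. *)
have := half_turns_unique h4 (half_turns_flip e21 h1); rewrite -mm' => mE.
have : (m + m = -1 :> int)%R by rewrite {1}mE; ring.
by case: m {mm' mE h1 h2} => n; rewrite ?NegzE; lia.
Qed.

End Angles.

(** * Conjugation of an element to its inverse *)

Section FuchsianAlgebra.
Variables (R : realType) (Gamma : fuchsian_group R).
Implicit Types (g h : 'M[R]_2) (q : R * R).

(* An element with entries a, b, c, d and trace 0 is elliptic: it fixes       *)
(* a / c + i / |c|.                                                           *)
Lemma fuchsian_trace_neq0 g : Gamma g -> g 0 0 + g 1 1 != 0.
Proof.
move=> Gg; apply/eqP => tr0.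
have dg := fuchsian_det Gg; have d2 := dg; rewrite det2 in d2.
have dE : g 1 1 = - g 0 0 by rewrite -[LHS](addKr (g 0 0)) tr0 addr0.
have c0 : g 1 0 != 0.
  apply/eqP => c0; move: d2; rewrite c0 mulr0 subr0 dE.
  by have := sqr_ge0 (g 0 0); rewrite expr2; lra.
have n0 : `|g 1 0| != 0 by rewrite normr_eq0.
pose q := (g 0 0 / g 1 0, `|g 1 0|^-1).
have qH : half_plane q by rewrite /half_plane /= invr_gt0 normr_gt0.
have n2 : `|g 1 0| ^+ 2 = g 1 0 ^+ 2 by rewrite real_normK ?num_real.
have den1 : mobius_den g q = 1.
  rewrite /mobius_den /q /= exprMn exprVn n2 divff ?sqrf_eq0// mulrC divfK//.
  by rewrite dE subrr expr0n add0r.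
have fix_q : mobius g q = q.
  rewrite mobiusE den1 dg !divr1 mul1r /= exprVn n2.
  rewrite [g 1 0 * _]mulrC divfK// dE subrr mulr0 add0r; congr (_, _).
  by field.
case: (fuchsian_free Gg qH fix_q) => gE; move: tr0; rewrite gE !mxE /=; lra.
Qed.

(* If h g = g^-1 h, then h has trace 0 unless g is scalar; if                 *)
(* h g = - g^-1 h, then g or h has trace 0.                                   *)
Lemma conj_eq_inverse g h q : Gamma g -> Gamma h -> half_plane q ->
  mobius (g * (h * g * h^-1)) q = q -> g = 1 \/ g = -1.
Proof.
move=> Gg Gh qH fq.
have dg := fuchsian_det Gg; have dh := fuchsian_det Gh.
have gU : g \is a GRing.unit by rewrite unitmxE dg unitr1.
have hU : h \is a GRing.unit by rewrite unitmxE dh unitr1.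
have Gk : Gamma (g * (h * g * h^-1)).
  by do ![apply: fuchsianM => //]; exact: fuchsianV.
have [i00 i01 i10 i11] := inv_mx2 dg.
have trg := fuchsian_trace_neq0 Gg; have trh := fuchsian_trace_neq0 Gh.
have hg (e : 'M[R]_2) : g * (h * g * h^-1) = e -> h * g = g^-1 * e * h.
  by move=> <-; rewrite mulKr// divrK.
case: (fuchsian_free Gk qH fq) => /hg kE.
  rewrite mulr1 in kE.
  have := congr1 (fun m : 'M[R]_2 => m 0 1) kE; have := congr1 (fun m : 'M[R]_2 => m 1 0) kE.
  have := congr1 (fun m : 'M[R]_2 => m 0 0) kE; have := congr1 (fun m : 'M[R]_2 => m 1 1) kE.
  rewrite /= !mulmx2E i00 i01 i10 i11 => e11 e00 e10 e01.
  (* Comparing entries gives [g 0 1], [g 1 0] and [g 0 0 - g 1 1], each times the trace of [h],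
     equal to 0. *)
  have b0 : g 0 1 = 0 by apply: (mulIf trh); rewrite mul0r; lra.
  have c0 : g 1 0 = 0 by apply: (mulIf trh); rewrite mul0r; lra.
  have ad : g 0 0 = g 1 1.
    by apply: (mulIf trh); apply/eqP; rewrite -subr_eq0; apply/eqP; lra.
  move: dg; rewrite det2 b0 mul0r subr0 ad => /eqP.
  rewrite -expr2 sqrf_eq1 => /orP[/eqP d1|/eqP d1]; [left|right].
    by apply: mx2_eq; rewrite ?ad ?d1 ?b0 ?c0 !mxE.
  by apply: mx2_eq; rewrite ?ad ?d1 ?b0 ?c0 !mxE /= ?oppr0.
rewrite mulrN1 mulNr in kE.
have kEij i j : (h * g) i j = - (g^-1 * h) i j by rewrite kE mxE.
have := kEij 0 0; have := kEij 1 1; rewrite !mulmx2E i00 i01 i10 i11 => e11 e00.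
(* Adding the diagonal entries leaves the product of the two traces. *)
have /eqP : (g 0 0 + g 1 1) * (h 0 0 + h 1 1) = 0 by lra.
by rewrite mulf_eq0 (negbTE trg) (negbTE trh).
Qed.

End FuchsianAlgebra.

(** * Lifting a circle in the surface to the half-plane *)

Section CircleLift.
Variables (R : realType) (Gamma : fuchsian_group R).
Local Notation H := (set_type (@half_plane R)).

Lemma within_comp_continuous (X Z : topologicalType) (A : set X) (f : X -> Z)
    (w : R -> X) :
  {within A, continuous f} -> continuous w -> (forall s, A (w s)) ->
  continuous (f \o w).
Proof.
move=> cf cw Aw s W nW.
have := cf (w s) W nW; rewrite /nbhs /= -nbhs_subspace_in// => nA.
have {}nA : \forall x \near w s, A x -> W (f x) by [].
have := cw s _ nA => ns.
have {}ns : \forall t \near s, A (w t) -> W (f (w t)) by [].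
suff: \forall t \near s, W (f (w t)) by [].
by apply: filterS ns => t; apply.
Qed.

(** [c] lifts the parametrised circle through the covering of the surface. A path [w] over [A] is
    first projected to the circle and lifted to the line, which yields [sigma]; this and the last
    clause follow from uniqueness of lifts. *)
Lemma circle_lift (A : set (surface Gamma)) q0 :
  homeomorphic A [set: circle R] -> lift_set A q0 ->
  exists c : R -> R * R,
  [/\ continuous c /\ c 0 = q0, forall s, half_plane (c s) /\ lift_set A (c s),
      forall s t, (exists2 g, Gamma g & mobius g (c s) = c t) <-> s - t \is a Num.int,
      forall w : R -> R * R, continuous w -> (forall s, lift_set A (w s)) ->
        w 0 = c 0 -> exists sigma : R -> R,
        [/\ continuous sigma, sigma 0 = 0 & forall s, w s = c (sigma s)]
    & forall g s0, Gamma g -> mobius g (c 0) = c s0 ->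
        forall s, mobius g (c s) = c (s + s0)].
Proof.
move=> [f [k [[cf ck] fA kA kf fk]]] [u0 Au0 u0E].
have ck' : continuous k.
  by apply/continuous_subspace_setT.
(* The phase [x0] makes the parametrisation start at the image of [q0]. *)
have [x0 x0E] := circle_pi_surj (f (surface_pi Gamma u0)).
pose gam s := k (circle_pi (s + x0)).
have cgam : continuous gam.
  move=> s; apply: continuous_comp; last exact: ck'.
  apply: continuous_comp; last exact: circle_pi_continuous.
  by apply: cvgD; [exact: cvg_id|exact: cvg_cst].
have fk' x : f (k x) = x by exact: fk.
have hH := @half_plane_hausdorff R.
have locH : forall u : H, exists U, [/\ open U, U u & set_inj U (surface_pi Gamma)].
  by case: (surface_covering Gamma).
have gam0 : surface_pi Gamma u0 = gam 0 by rewrite /gam add0r x0E kf.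
have [cH [ccH cH0 cHE]] := path_lifting hH (surface_covering Gamma) cgam gam0.
have valc (w : R -> H) : continuous w -> continuous (fun s => val (w s)).
  by move=> cw s; apply: continuous_comp; [exact: cw|exact: initial_continuous].
have orbE (u v : H) : surface_pi Gamma u = surface_pi Gamma v <->
    exists2 g, Gamma g & mobius g (val u) = val v by exact: surface_piP.
have gamE s t : gam s = gam t <-> s - t \is a Num.int.
  split=> [/(congr1 f)|st].
    rewrite /gam !fk' => /circle_piP.
    by rewrite opprD addrACA subrr addr0.
  congr k; apply/circle_piP.
  by rewrite opprD addrACA subrr addr0.
exists (fun s => val (cH s)); split.
- by split; [exact: valc|rewrite cH0].
- move=> s; split; first exact: set_valP.
  by exists (cH s) => //; rewrite /= cHE; exact: kA.
- by move=> s t; rewrite -orbE !cHE.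
- move=> w cw wA w0.
  have wA' s : exists u : H, A (surface_pi Gamma u) /\ set_val u = w s.
    by have [u Au uE] := wA s; exists u.
  have [wH wHP] := choice wA'.
  have cwH : continuous wH.
    apply: (@continuous_comp_initial _ _ _ set_val).
    by rewrite (_ : _ \o _ = w)//; apply/funext => s /=; exact: (wHP s).2.
  have cpw : continuous (surface_pi Gamma \o wH).
    by move=> s; apply: continuous_comp; [exact: cwH|exact: pi_continuous].
  have cka := within_comp_continuous cf cpw (fun s => (wHP s).1).
  have wH0 : wH 0 = u0.
    apply/val_inj; transitivity (w 0); first exact: (wHP 0).2.
    by rewrite w0 cH0.
  have [|sg [csg sg0 sgE]] := path_lifting (@Rhausdorff R) (circle_covering R) cka (x0 := x0).
    by rewrite /= wH0.
  exists (fun s => sg s - x0); split.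
  + by move=> s; apply: cvgB; [exact: csg|exact: cvg_cst].
  + by rewrite sg0 subrr.
  + have lifts : wH = (fun s => cH (sg s - x0)).
      apply: (@lift_unique R _ _ (surface_pi Gamma) _ _ 0 hH locH cwH).
      * move=> s; apply: continuous_comp; last exact: ccH.
        by apply: cvgB; [exact: csg|exact: cvg_cst].
      * move=> s; rewrite cHE /gam subrK sgE /= kf//; exact: (wHP s).1.
      * by rewrite sg0 subrr wH0 cH0.
    by move=> s; rewrite -(wHP s).2 lifts.
- move=> g s0 Gg gE s.
  (* As [s0] is an integer, the shift by [s0] does not change the path in the surface. *)
  have s0int : s0 \is a Num.int.
    have : gam 0 = gam s0 by rewrite -!cHE; apply/orbE; exists g.
    by move/gamE; rewrite sub0r rpredN.
  have lifts : (fun s => half_plane_act g (cH s)) = (fun s => cH (s + s0)).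
    apply: (@lift_unique R _ _ (surface_pi Gamma) _ _ 0 hH locH).
    + move=> t; apply: continuous_comp; [exact: ccH|exact: (half_plane_act_continuous Gg)].
    + move=> t; apply: continuous_comp; last exact: ccH.
      by apply: cvgD; [exact: cvg_id|exact: cvg_cst].
    + move=> t; transitivity (surface_pi Gamma (cH t)).
        by apply/esym/orbE; exists g => //; rewrite (half_plane_actE _ Gg).
      by rewrite !cHE; apply/gamE; rewrite opprD addrA subrr sub0r rpredN.
    + by apply/val_inj; rewrite (half_plane_actE _ Gg) add0r.
  by rewrite -(half_plane_actE _ Gg); move/(congr1 (fun F => val (F s))): lifts.
Qed.

End CircleLift.

(** * Injective maps of the circle *)

Section Degree.
Variable R : realType.

Lemma IVT_value (f : R -> R) a b v : continuous f -> a <= b ->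
  (f a - v) * (f b - v) <= 0 -> exists2 c, a <= c <= b & f c = v.
Proof.
move=> cf ab fab; have cg : continuous (fun x => f x - v).
  by move=> x; apply: cvgB; [exact: cf|exact: cvg_cst].
have [c cab /eqP] := IVT0 cg ab fab.
by rewrite subr_eq0 => /eqP cE; exists c.
Qed.

Lemma int_lt1 (x : R) : x \is a Num.int -> -1 < x -> x < 1 -> x = 0.
Proof.
move=> /intrP[n ->]; rewrite (_ : -1 = (-1)%:~R)// (_ : 1 = 1%:~R)// !ltr_int => h1 h2.
by rewrite (_ : n = 0)//; lia.
Qed.

(** By continuity [sigma (s + 1) - sigma s] is a constant integer [n], and injectivity modulo 1
    forces [n] to be 1 or -1. Then [sigma] is injective on the line, hence monotone. *)
Lemma circle_map_degree (sigma : R -> R) : continuous sigma -> sigma 0 = 0 ->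
  (forall s, sigma (s + 1) - sigma s \is a Num.int) ->
  (forall s t, sigma s - sigma t \is a Num.int -> s - t \is a Num.int) ->
  (forall s t, s < t -> sigma s < sigma t) \/
  (forall s t, s < t -> sigma t < sigma s) /\
  forall s, sigma (s + 1) = sigma s - 1.
Proof.
move=> cs s0 dint sinj.
have cd (s : R) : {for s, continuous (fun s : R => sigma (s + 1) - sigma s)}.
  apply: cvgB; last exact: cs.
  apply: (@continuous_comp _ _ _ (fun s : R => s + 1) sigma); last exact: cs.
  by apply: cvgD; [exact: cvg_id|exact: cvg_cst].
have [n nE] : exists n : int, forall s, sigma (s + 1) = sigma s + n%:~R.
  have /intrP[n nE] := dint 0; exists n => s.
  suff e : sigma (s + 1) - sigma s = sigma (0 + 1) - sigma 0.
    by rewrite -nE -e [RHS]addrC subrK.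
  have [s_ge|/ltW s_le] := leP 0 s.
    symmetry; exact: (@int_valued_constant R (fun s : R => sigma (s + 1) - sigma s)
      0 s s_ge (fun t _ => cd t) (fun t _ => dint t)).
  exact: (@int_valued_constant R (fun s : R => sigma (s + 1) - sigma s)
      s 0 s_le (fun t _ => cd t) (fun t _ => dint t)).
have nEk (k : int) s : sigma (s + k%:~R) = sigma s + (n * k)%:~R.
  have nat_case (m : nat) t : sigma (t + m%:~R) = sigma t + (n * m)%:~R.
    elim: m => [|m IH]; first by rewrite mulr0 !addr0.
    rewrite (_ : m.+1%:~R = m%:~R + 1 :> R); last by rewrite -intrD1 -addn1 PoszD.
    by rewrite addrA nE IH -addrA -intrD (_ : n * m.+1 = n * m + n)//; lia.
  case: k => m; first exact: nat_case.
  have := nat_case m.+1 (s + (Negz m)%:~R).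
  rewrite -addrA -intrD NegzE addNr addr0 => ->.
  by rewrite -addrA -intrD mulrN subrr addr0.
have half_int (k : int) (x : R) : 0 < x -> x < 1 -> x = k%:~R -> False.
  move=> x0 x1 xE; have xi : x \is a Num.int by rewrite xE intr_int.
  by have := int_lt1 xi; lra.
have noint (a b : R) : 0 < b - a -> b - a < 1 -> sigma b - sigma a \is a Num.int -> False.
  move=> ab0 ab1 /sinj /intrP[k kE]; exact: half_int ab0 ab1 kE.
have s1 : sigma 1 = n%:~R by have := nE 0; rewrite add0r s0 add0r.
(* In degree 0, half the value at 1/2 is taken both before and after 1/2. *)
have n0 : n != 0.
  apply/eqP => n0; rewrite n0 in s1.
  have h0 : (0 : R) <= 2^-1 by rewrite invr_ge0.
  have h1 : (2^-1 : R) <= 1 by lra.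
  have [|a /andP[a0 a1] aE] := IVT_value (v := sigma 2^-1 / 2) cs h0.
    by rewrite s0; have := sqr_ge0 (sigma 2^-1); rewrite expr2; lra.
  have [|b /andP[b0 b1] bE] := IVT_value (v := sigma 2^-1 / 2) cs h1.
    by rewrite s1; have := sqr_ge0 (sigma 2^-1); rewrite expr2; lra.
  have sh : sigma 2^-1 != 0.
    apply/eqP => sh; apply: (noint 0 2^-1); [lra|lra|].
    by rewrite sh s0 subrr.
  have ah : a != 2^-1 by apply/eqP => ah; move: aE sh; rewrite ah => aE /eqP; apply; lra.
  have a00 : a != 0 by apply/eqP => a00; move: aE sh; rewrite a00 s0 => aE /eqP; apply; lra.
  have lta : a < 2^-1 by rewrite lt_neqAle ah.
  have gta : 0 < a by rewrite lt_neqAle eq_sym a00.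
  by apply: (noint a b); [lra|lra|rewrite aE bE subrr].
(* In higher degree, the value 1 or -1 is taken strictly between 0 and 1, although it is congruent
   to [sigma 0]. *)
have n1 : `|n| = 1.
  apply: contrapT => n1.
  have [k [k0 kn]] : exists k : int, `|k| = 1 /\ 0 < k * n.
    by exists (if 0 < n then 1 else -1); case: ifP; lia.
  have kn2 : 2 <= k * n by lia.
  have [||c /andP[c0 c1] cE] := @IVT_value sigma 0 1 k%:~R cs _ _; first by [].
    rewrite s0 s1 sub0r mulNr oppr_le0 -intrB -intrM ler0z.
    have kk : k * k = 1 by case: (ltrP 0 k) => ?; [have -> : k = 1 by lia|have -> : k = -1 by lia].
    rewrite mulrBr kk; lia.
  have cn0 : c != 0.
    apply/eqP => c00; move: cE; rewrite c00 s0 => /esym/eqP; rewrite intr_eq0; lia.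
  have cn1 : c != 1.
    apply/eqP => c00; move: cE; rewrite c00 s1 => /eqP; rewrite eqr_int; lia.
  apply: (noint 0 c).
  - by rewrite subr0 lt_neqAle eq_sym cn0.
  - by rewrite subr0 lt_neqAle cn1.
  - by rewrite cE s0 subr0 intr_int.
have inj : injective sigma.
  move=> a b ab; have /intrP[k kE] : a - b \is a Num.int by apply: sinj; rewrite ab subrr.
  have aE : a = b + k%:~R by rewrite -kE addrC subrK.
  move: ab; rewrite aE nEk -{2}[sigma b]addr0 => /addrI/eqP.
  rewrite intr_eq0 mulf_eq0 (negbTE n0)/= => /eqP ->.
  by rewrite addr0.
have cw : {within [set` `]-oo, +oo[%R], continuous sigma} by exact: continuous_subspaceT.
have inf x : x \in `]-oo, +oo[%R by rewrite in_itv.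
have [mono|mono] := itv_continuous_inj_mono cw (in2W inj); [left|right].
  by move=> s t; apply: mono; exact: inf.
have dec s t : s < t -> sigma t < sigma s by move=> st; apply: mono => //; exact: inf.
split => //.
have sig1 : sigma 1 < sigma 0 by apply: dec.
move=> s; rewrite nE; congr (_ + _).
move: sig1; rewrite s1 s0 ltrz0 => nneg.
by rewrite (_ : n = -1)//; lia.
Qed.

End Degree.

Lemma fuchsian_expz (R : realType) (Gamma : fuchsian_group R) g (a : int) :
  Gamma g -> Gamma (g ^ a).
Proof.
move=> Gg; have nat_case n : Gamma (g ^+ n).
  elim: n => [|n IH]; first by rewrite expr0; exact: fuchsian1.
  by rewrite exprS; exact: fuchsianM.
by case: a => n; [exact: nat_case|apply: fuchsianV; exact: nat_case].
Qed.

(** * Isotopy of the return map to the identity *)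

Section Isotopy.
Variables (R : realType) (V : R -> R * R -> R * R) (Y : R -> R -> R * R -> R * R).
Variable B : R.
Hypothesis Vc : forall t q, half_plane q ->
  {for (t, q), continuous (fun u : R * (R * R) => V u.1 u.2)}.
Hypothesis VB : forall t q, half_plane q -> `|V t q| <= B * q.2.
Hypothesis VY : solution_map V Y.

Lemma flow_iter_half_plane t n q : half_plane q -> half_plane (iter n (Y t 0) q).
Proof. by move=> qH; elim: n => //= n IH; exact: flow_half_plane VY _ _ IH. Qed.

Lemma flow_iter_inj t n q q' : half_plane q -> half_plane q' ->
  iter n (Y t 0) q = iter n (Y t 0) q' -> q = q'.
Proof.
move=> qH q'H; elim: n => //= n IH e; apply: IH.
by apply: (flow_inj VY _ _ e); exact: flow_iter_half_plane.
Qed.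

Lemma flow_iter_continuous (X : topologicalType) (tau : X -> R) (q : X -> R * R) x n :
  {for x, continuous tau} -> {for x, continuous q} -> half_plane (q x) ->
  {for x, continuous (fun y => iter n (Y (tau y) 0) (q y))}.
Proof.
move=> ct cq qH; elim: n => // n IH /=.
apply: (@continuous_comp _ _ _ (fun y => (tau y, iter n (Y (tau y) 0) (q y)))
  (fun u => Y u.1 0 u.2)).
  exact: continuous_pair.
apply: flow_jointly_continuous Vc VB VY _ _ _.
exact: flow_iter_half_plane.
Qed.

(** For an injective loop the difference of antipodal points is an odd loop that avoids 0. The
    isotopy carries the one for [c] to the one for [c \o sigma], and deforming [sigma] to - s
    carries this to its reversal, against [odd_loop_not_reversible]. *)
Lemma no_reversed_loop (T : R) (b : nat) (h : 'M[R]_2) (c : R -> R * R)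
    (sigma : R -> R) :
  \det h = 1 -> continuous c -> (forall s, half_plane (c s)) ->
  (forall s, c (s + 1) = c s) ->
  (forall s t, c s = c t -> s - t \is a Num.int) ->
  continuous sigma -> (forall s t, s < t -> sigma t < sigma s) ->
  (forall s, sigma (s + 1) = sigma s - 1) ->
  (forall s, mobius h (iter b (Y T 0) (c s)) = c (sigma s)) -> False.
Proof.
move=> dh cc cH cper cinj cs sdec sper hc.
(* With \tr k >= 0, the segment from 1 to k has positive determinants, which  *)
(* makes mobius k isotopic to the identity.                                   *)
have [k [dk kE trk]] : exists k : 'M[R]_2, [/\ \det k = 1,
    forall q, mobius k q = mobius h q & 0 <= k 0 0 + k 1 1].
  have [tr|/ltW tr] := leP 0 (h 0 0 + h 1 1); first by exists h.
  exists (- h); split; [|exact: mobiusN|by rewrite !mxE; lra].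
  by rewrite -dh !det2 !mxE; ring.
(* Time is clamped because the homotopies must be defined on the whole plane. *)
pose t01 : R -> R := clamp 0 1.
have ct01 := @continuous_clamp R 0 1.
have t01P t : 0 <= t01 t <= 1 by apply: clamp_itv.
have t010 : t01 0 = 0 by apply: clampE; rewrite lexx ler01.
have t011 : t01 1 = 1 by apply: clampE; rewrite lexx ler01.
pose G (t : R) : 'M[R]_2 := (1 - t01 t) *: 1 + t01 t *: k.
have dG t : 0 < \det (G t).
  have /andP[a1 a2] := t01P t; rewrite det2 !mxE /= !mulr1n !mulr0n.
  move: dk; rewrite det2 => dk.
  have := mulr_ge0 (mulr_ge0 a1 (_ : 0 <= 1 - t01 t)) trk; rewrite subr_ge0 => /(_ a2) p0.
  apply: lt_le_trans (_ : (1 - t01 t) ^+ 2 + t01 t ^+ 2 <= _); last first.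
    rewrite -subr_ge0 (_ : _ - _ = t01 t * (1 - t01 t) * (k 0 0 + k 1 1)
      + t01 t ^+ 2 * (k 0 0 * k 1 1 - k 0 1 * k 1 0 - 1)); last by ring.
    by rewrite dk subrr mulr0 addr0.
  have := sqr_ge0 (t01 t - 2^-1); rewrite !expr2; lra.
have G0 : G 0 = 1 by rewrite /G t010 subr0 scale1r scale0r addr0.
have G1 : G 1 = k by rewrite /G t011 subrr scale0r scale1r add0r.
(* The duration of the [b] iterated flow maps shrinks from [T] to 0 while the matrix moves from [k]
   to 1; each stage is injective. *)
pose W (s t : R) := mobius (G t) (iter b (Y (t01 t * T) 0) (c s)).
have iH t s : half_plane (iter b (Y (t01 t * T) 0) (c s)) by exact: flow_iter_half_plane.
have cW (e : R) : continuous (fun u : R * R => W (u.1 + e) u.2).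
  move=> u; apply: (@mobius_continuous R _ (fun u : R * R => G u.2)
    (fun u => iter b (Y (t01 u.2 * T) 0) (c (u.1 + e)))); [|..|exact: iH].
  - move=> i j.
    have cG : continuous (fun t : R => G t i j).
      move=> t; rewrite (_ : (fun t => G t i j) =
        (fun t => (1 - t01 t) * (1 : 'M[R]_2) i j + t01 t * k i j)); last first.
        by apply/funext => r; rewrite !mxE.
      apply: cvgD; apply: cvgM; [|exact: cvg_cst|exact: ct01|exact: cvg_cst].
      by apply: cvgB; [exact: cvg_cst|exact: ct01].
    by apply: (@continuous_comp _ _ _ snd (fun t => G t i j)); [exact: cvg_snd|exact: cG].
  - apply: flow_iter_continuous => //.
      apply: (@continuous_comp _ _ _ snd (fun t => t01 t * T)); first exact: cvg_snd.
      by apply: cvgM; [exact: ct01|exact: cvg_cst].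
    apply: (@continuous_comp _ _ _ (fun u => u.1 + e) c); last exact: cc.
    by apply: cvgD; [exact: cvg_fst|exact: cvg_cst].
  - by rewrite gt_eqF.
have Winj s s' t : W s t = W s' t -> s - s' \is a Num.int.
  move=> e; apply: cinj; apply: (@flow_iter_inj (t01 t * T) b) => //.
  exact: mobius_inj (dG t) (iH _ _) (iH _ _) e.
have Y0 q : half_plane q -> iter b (Y 0 0) q = q.
  by move=> qH; elim: (b) => //= n ->; have [_ ] := VY 0 qH.
have W0 s : W s 0 = c s by rewrite /W G0 t010 mul0r Y0// mobius1.
have W1 s : W s 1 = c (sigma s) by rewrite /W G1 t011 mul1r kE hc.
have half_notint (x : R) : 0 < x -> x < 1 -> x \is a Num.int -> False.
  by move=> x0 x1 /int_lt1 h0; have := h0; lra.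
(* A convex combination of [sigma] and - s: it remains decreasing of degree -1, so points half a
   period apart keep distinct images under [c]. *)
pose sg (t s : R) := (1 - t01 t) * sigma s - t01 t * s.
pose F1 (u : R * R) := W (u.1 + 0) u.2 - W (u.1 + 2^-1) u.2.
pose F2 (u : R * R) := c (sg u.2 u.1) - c (sg u.2 (u.1 + 2^-1)).
have hh : (2^-1 + 2^-1 : R) = 1 by lra.
have csg (e : R) : continuous (fun u : R * R => sg u.2 (u.1 + e)).
  move=> u; have c2 : {for u, continuous (fun u : R * R => t01 u.2)}.
    by apply: (@continuous_comp _ _ _ snd t01); [exact: cvg_snd|exact: ct01].
  have c1 : {for u, continuous (fun u : R * R => u.1 + e)}.
    by apply: cvgD; [exact: cvg_fst|exact: cvg_cst].
  have c3 : {for u, continuous (fun u : R * R => sigma (u.1 + e))}.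
    by apply: (@continuous_comp _ _ _ (fun u : R * R => u.1 + e) sigma) => //; exact: cs.
  by apply: cvgB; apply: cvgM => //; apply: cvgB => //; exact: cvg_cst.
apply: (@odd_loop_not_reversible R F1 F2).
- by move=> u; apply: cvgB; exact: cW.
- move=> u; apply: cvgB.
    apply: (@continuous_comp _ _ _ (fun u : R * R => sg u.2 u.1) c); last exact: cc.
    have := csg 0 u; rewrite (_ : (fun u => _) = (fun u => sg u.2 u.1))//.
    by apply/funext => v; rewrite addr0.
  apply: (@continuous_comp _ _ _ (fun u : R * R => sg u.2 (u.1 + 2^-1)) c).
    exact: csg.
  exact: cc.
- move=> u; rewrite /F1 subr_eq0; apply/eqP => /esym/Winj.
  rewrite addr0 addrC addKr; apply: half_notint; lra.
- move=> [s t]; rewrite /F2 /= subr_eq0; apply/eqP => /cinj.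
  have /andP[a1 a2] := t01P t.
  have d1 : sigma (s + 2^-1) < sigma s by apply: sdec; lra.
  have d2 : sigma (s + 1) < sigma (s + 2^-1) by apply: sdec; lra.
  rewrite sper in d2.
  have -> : sg t s - sg t (s + 2^-1) = (1 - t01 t) * (sigma s - sigma (s + 2^-1)) + t01 t / 2.
    by rewrite /sg; ring.
  apply: half_notint; nra.
- move=> t; rewrite /F1 /= !add0r addr0 hh opprB; congr (_ - _).
  by rewrite /W -[1]add0r cper.
- move=> t; rewrite /F2 /= !add0r hh opprB; congr (_ - _).
  have -> : sg t 1 = sg t 0 - 1 by rewrite /sg -[X in sigma X]add0r sper; ring.
  by rewrite -[LHS](cper (sg t 0 - 1)) subrK.
- by move=> s; rewrite /F1 /F2 /= !W1 addr0 /sg t010 !mul0r !subr0 !mul1r.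
- move=> s _; rewrite /F1 /F2 /= !W0 addr0 /sg t011 subrr !mul0r !sub0r !mul1r opprB.
  congr (_ - _); rewrite -[LHS]cper; congr c; lra.
Qed.

End Isotopy.

(** * Invariant circles through an inversely unstable point *)

Section InvariantCircle.
Variables (R : realType) (Gamma : fuchsian_group R).
Variables (V : R -> R * R -> R * R) (Y : R -> R -> R * R -> R * R) (B : R).
Hypothesis Vc : forall t q, half_plane q ->
  {for (t, q), continuous (fun u : R * (R * R) => V u.1 u.2)}.
Hypothesis VB : forall t q, half_plane q -> `|V t q| <= B * q.2.
Hypothesis VY : solution_map V Y.
Hypothesis Vcomp : compatible Gamma V.

Lemma flow_iter_equivariant t n g q : Gamma g -> half_plane q ->
  iter n (Y t 0) (mobius g q) = mobius g (iter n (Y t 0) q).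
Proof.
move=> Gg qH; elim: n => //= n ->.
by apply: (flow_equivariant Vcomp) => //; exact: flow_iter_half_plane VY _ _ _ qH.
Qed.

Lemma lift_set_mobius (A : set (surface Gamma)) g q : Gamma g ->
  lift_set A q -> lift_set A (mobius g q).
Proof.
move=> Gg [u Au <-]; exists (half_plane_act g u); last exact: half_plane_actE Gg.
rewrite /preimage /= (_ : surface_pi Gamma _ = surface_pi Gamma u)//.
by apply/esym/surface_piP; exists g => //; rewrite (half_plane_actE _ Gg).
Qed.

Lemma lift_set_flow_iter (A : set (surface Gamma)) T n q :
  push_set Gamma (Y T 0 @` lift_set A) `<=` A ->
  lift_set A q -> lift_set A (iter n (Y T 0) q).
Proof.
move=> PA Aq; elim: n => //= n IH.
have pH : half_plane (iter n (Y T 0) q) by case: IH => u _ <-; exact: set_valP.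
have uP : Y T 0 (iter n (Y T 0) q) \in @half_plane R.
  by apply/mem_set; exact: flow_half_plane VY _ _ pH.
pose u : set_type (@half_plane R) := SigSub uP.
have uE : set_val u = Y T 0 (iter n (Y T 0) q) by [].
by exists u => //; apply: PA; exists u => //=; exists (iter n (Y T 0) q).
Qed.

(** The lifted circle carries M to a monotone [sigma]; the increasing case contradicts
    [saddle_curve], the decreasing one [no_reversed_loop]. *)
Lemma invariant_circle_not_inversely_unstable (A : set (surface Gamma)) T
    (g : 'M[R]_2) (a : int) (b : nat) (q0 : R * R) :
  push_set Gamma (Y T 0 @` lift_set A) `<=` A -> lift_set A q0 -> Gamma g ->
  inversely_unstable_at (return_map (Y T 0) g a b) q0 ->
  ~ homeomorphic A [set: circle R].
Proof.
move=> PA Aq0 Gg iu hom.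
have [c [[cc c0] cHA corb clift cdeck]] := circle_lift hom Aq0.
have cH s : half_plane (c s) by case: (cHA s).
have cA s : lift_set A (c s) by case: (cHA s).
pose h := g ^ (- a); have Gh : Gamma h by exact: fuchsian_expz.
have dh := fuchsian_det Gh.
have hV : Gamma h^-1 by exact: fuchsianV.
pose M := return_map (Y T 0) g a b.
have ME q : M q = mobius h (iter b (Y T 0) q) by [].
have iH q : half_plane q -> half_plane (iter b (Y T 0) q).
  by move=> qH; exact: flow_iter_half_plane VY _ _ _ qH.
have MH q : half_plane q -> half_plane (M q).
  by move=> qH; rewrite ME; apply: mobius_half_plane; rewrite ?dh//; exact: iH.
have Mc0 : M (c 0) = c 0.
  by rewrite c0; case: iu => [? [? [? [? [? [? [[]]]]]]]].
have mMl k1 k2 q : Gamma k2 -> half_plane q ->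
    mobius k1 (mobius k2 q) = mobius (k1 * k2) q.
  by move=> Gk2 qH; rewrite mobiusM// (fuchsian_det Gk2).
(* M commutes with the deck group up to conjugation by [h], so it respects orbits; this yields
   [sg_step] and, with injectivity of the flow, [sg_inj]. *)
have Mconj k q : Gamma k -> half_plane q -> M (mobius k q) = mobius (h * k * h^-1) (M q).
  move=> Gk qH; rewrite !ME flow_iter_equivariant// !mMl//; try exact: iH.
  by rewrite mulrVK// unitmxE dh unitr1.
have cM : continuous (fun s => M (c s)).
  move=> s; apply: (@mobius_continuous R _ (fun=> h) (fun s => iter b (Y T 0) (c s))).
  - by move=> i j; exact: cst_continuous.
  - apply: (flow_iter_continuous Vc VB VY (tau := fun=> T)).
    + exact: cst_continuous.
    + exact: cc.
    + exact: cH.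
  - by rewrite dh oner_eq0.
  - exact: iH.
have [|sigma [csg sg0 sgE]] := clift _ cM _ Mc0.
  by move=> s; rewrite ME; apply: lift_set_mobius => //; exact: lift_set_flow_iter.
have cint s t : c s = c t -> s - t \is a Num.int.
  by move=> e; apply/corb; exists 1; [exact: fuchsian1|rewrite mobius1].
have Gconj k : Gamma k -> Gamma (h * k * h^-1).
  by move=> Gk; apply: fuchsianM => //; exact: fuchsianM.
have sg_step s : sigma (s + 1) - sigma s \is a Num.int.
  have : s - (s + 1) \is a Num.int by rewrite opprD addrA subrr sub0r rpredN rpred1.
  move=> /corb[k Gk kE]; rewrite -opprB rpredN; apply/corb.
  by exists (h * k * h^-1); [exact: Gconj|rewrite -!sgE -kE Mconj].
have sg_inj s t : sigma s - sigma t \is a Num.int -> s - t \is a Num.int.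
  move=> /corb[k Gk kE]; apply/corb; exists (h^-1 * k * h).
    by apply: fuchsianM => //; exact: fuchsianM.
  have Gk' : Gamma (h^-1 * k * h) by apply: fuchsianM => //; exact: fuchsianM.
  have kH : half_plane (mobius (h^-1 * k * h) (c s)).
    by apply: mobius_half_plane; rewrite ?(fuchsian_det Gk').
  apply: (flow_iter_inj VY (t := T) (n := b)) => //.
  apply: (@mobius_inj R h); rewrite ?dh//; [exact: iH|exact: iH|].
  have hU : h \is a GRing.unit by rewrite unitmxE dh unitr1.
  by rewrite -!ME Mconj// !mulrA divrr// mul1r mulrK// !sgE.
have [sinc|[sdec sper]] := circle_map_degree csg sg0 sg_step sg_inj.
  apply: (saddle_curve iu cc c0 _ sgE csg sg0 sinc) => s /andP[s0 s1].
  rewrite -c0 => /cint; rewrite subr0 => /int_lt1 h0.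
  by have := h0; lra.
have [k Gk kE] : exists2 k, Gamma k & mobius k (c 0) = c 1.
  by apply/corb; rewrite sub0r rpredN rpred1.
have kshift := cdeck k 1 Gk kE.
have k1 : k = 1 \/ k = -1.
  (* M sends c(1) = k c(0) to c(-1), so [h * k * h^-1] maps c(0) to c(-1), and [k] brings it
     back. *)
  apply: (@conj_eq_inverse R Gamma k h (c 0)) => //.
  rewrite -mMl//; last exact: Gconj.
  rewrite -[X in mobius (h * k * h^-1) X]Mc0 -Mconj// kE sgE.
  by rewrite -[X in sigma X]add0r sper sg0 kshift sub0r addNr.
have cper s : c (s + 1) = c s.
  by rewrite -kshift; case: k1 => ->; rewrite ?mobiusN mobius1.
by apply: (no_reversed_loop Vc VB VY dh cc cH cper cint csg sdec sper) => s; exact: sgE.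
Qed.

End InvariantCircle.

Theorem theorem4p1 (R : realType) (p : nat)
    (Gamma : fuchsian_group R) (D : fundamental_region Gamma)
    (lo hi : R * R) (phi : R * R -> R * R)
    (k : nat) (psi : 'I_k -> R -> R -> R -> R) (f g : 'I_k -> R -> R -> R)
    (T : R) (V : R -> R * R -> R * R) (Y : R -> R -> R * R -> R * R)
    (K N A : set (surface Gamma)) (z : R -> R * R) :
  has_genus D p ->
  modified_region D lo hi phi ->
  regular_data psi f g (rectangle lo hi) ->
  0 < T ->
  periodic_system psi f g (rectangle lo hi) T ->
  represents D phi (sysF psi f) (sysG psi g) T V ->
  zero_sets_form_closed_trajectory D phi (rectangle lo hi) psi V ->
  solution_map V Y ->
  closed_curve R K ->
  dissipative_on V K N ->
  attractor (poincare Y T) N A ->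
  lift_set A (z 0) ->
  inversely_unstable D V (poincare Y T) T z ->
  ~ homeomorphic A [set: circle R].
Proof.
move=> _ _ _ T0 _ [Vc Vcomp VT _] _ VY _ _ [_ _ PA _] Az [i [a [b [_ iu]]]].
have [B VB] := field_bound Vc Vcomp D T0 VT.
apply: (invariant_circle_not_inversely_unstable Vc VB VY Vcomp _ Az _ iu).
- by rewrite [X in X `<=` _]PA.
- exact: trans_Gamma.
Qed.
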